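(* Let $(\mathfrak{g}_0,\sigma;\theta)$ be an irreducible non-compact semisimple symmetric pair equipped with a Cartan involution. Then the dual $(\mathfrak{g}_0,\sigma;\theta)^*$ satisfies (T-a) (resp. (T-b), (T-c), (T-d)) if and only if $(\mathfrak{g}_0,\sigma;\theta)$ satisfies (P-a) (resp. (P-b), (P-c), (P-d)), where the conditions (P-a)–(P-d) and (T-a)–(T-d) are those listed in the context.
   Context: An involution on a real Lie algebra $\mathfrak{l}$ is an automorphism $\nu$ with $\nu^2=\operatorname{id}$ (the identity is allowed); $\mathfrak{l}^{\pm\nu}$ are its $(\pm1)$-eigenspaces. $(\mathfrak{g}_0,\sigma;\theta)$ consists of a non-compact real semisimple Lie algebra $\mathfrak{g}_0$, an involution $\sigma$ and a Cartan involution $\theta$ of $\mathfrak{g}_0$ with $\theta\sigma=\sigma\theta$; it is irreducible if $\mathfrak{g}_0$ has no $\sigma$-invariant ideals other than $\{0\}$ and $\mathfrak{g}_0$. Its dual is the triad $(\mathfrak{g}_0,\sigma;\theta)^*:=(\mathfrak{g},\theta|_{\mathfrak{g}},\sigma|_{\mathfrak{g}})$ with $\mathfrak{g}:=\mathfrak{g}_0^{\theta}+\sqrt{-1}\mathfrak{g}_0^{-\theta}\subset(\mathfrak{g}_0)_{\mathbb{C}}$, using $\mathbb{C}$-linear extensions of $\theta,\sigma$. The relation $\equiv$ between triples (of either kind) means existence of a Lie algebra isomorphism intertwining the corresponding two involutions. On $\mathfrak{l}\oplus\mathfrak{l}$: $\rho(X,Y):=(Y,X)$, $(\nu_1\oplus\nu_2)(X,Y):=(\nu_1(X),\nu_2(Y))$.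 A complex structure on a real Lie algebra is an $\mathbb{R}$-linear $J$ with $J^2=-\operatorname{id}$ and $[JX,Y]=J[X,Y]$. Types of $(\mathfrak{g}_0,\sigma;\theta)$: (P-a) $\mathfrak{g}_0$ is real simple with a complex structure $J$ and $\sigma J=-J\sigma$. (P-b) $\mathfrak{g}_0$ is real simple with a complex structure $J$ and $\sigma J=J\sigma$. (P-c) $(\mathfrak{g}_0,\sigma;\theta)\equiv(\mathfrak{g}_0'\oplus\mathfrak{g}_0',\rho;\theta|_{\mathfrak{g}_0'}\oplus\theta|_{\mathfrak{g}_0'})$ for some $\theta$-invariant simple ideal $\mathfrak{g}_0'$ of $\mathfrak{g}_0$ with a complex structure. (P-d) the same as (P-c) but with $\mathfrak{g}_0'$ without complex structures. Types of a triad $(\mathfrak{g},\theta_1,\theta_2)$ (each: there exists a compact simple Lie algebra $\mathfrak{u}$ such that): (T-a) $(\mathfrak{g},\theta_1,\theta_2)\equiv(\mathfrak{u}\oplus\mathfrak{u},\rho,\rho\circ(\nu\oplus\nu))$ for some involution $\nu$ on $\mathfrak{u}$. (T-b) $(\mathfrak{g},\theta_1,\theta_2)\equiv(\mathfrak{u}\oplus\mathfrak{u},\rho,\nu\oplus\nu)$ for some involution $\nu$ on $\mathfrak{u}$. (T-c) $(\mathfrak{g},\theta_1,\theta_2)\equiv(\mathfrak{u}\oplus\mathfrak{u}\oplus\mathfrak{u}\oplus\mathfrak{u},\rho_{(12)(34)},\rho_{(14)(23)})$, where $\rho_{(12)(34)}(X,Y,Z,W)=(Y,X,W,Z)$ and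 $\rho_{(14)(23)}(X,Y,Z,W)=(W,Z,Y,X)$. (T-d) $(\mathfrak{g},\theta_1,\theta_2)\equiv(\mathfrak{u}\oplus\mathfrak{u},\nu\oplus\nu,\rho)$ for some involution $\nu$ on $\mathfrak{u}$. *)

(* Defs.v *)
(* The field of real numbers is an arbitrary [R : realType]; a real Lie algebra
   is a finite-dimensional one, i.e. a Lie bracket on a [vectType R]. *)
From HB Require Import structures.
From mathcomp Require Import all_boot all_order all_algebra.
From mathcomp Require Import ring reals.

Set Implicit Arguments.
Unset Strict Implicit.
Unset Printing Implicit Defensive.

Import Order.TTheory GRing.Theory Num.Theory.
Local Open Scope ring_scope.

HB.mixin Record Vector_isLieAlgebra (K : fieldType) L of Vector K L := {
  lie : L -> L -> L;
  lie_linearl : forall y : L, linear (fun x => lie x y);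
  lie_linearr : forall x : L, linear (lie x);
  liexx : forall x : L, lie x x = 0;
  lie_jacobi : forall x y z : L,
    lie x (lie y z) + lie y (lie z x) + lie z (lie x y) = 0
}.

#[short(type="lieAlgType")]
HB.structure Definition LieAlgebra (K : fieldType) :=
  { L of Vector K L & Vector_isLieAlgebra K L }.

Section LieLinear.
Variables (K : fieldType) (L : lieAlgType K).

HB.instance Definition _ (x : L) :=
  GRing.isLinear.Build K L L _ (lie x) (lie_linearr x).

Lemma lieDl (x y z : L) : lie (x + y) z = lie x z + lie y z.
Proof. by have := lie_linearl z 1 x y; rewrite !scale1r. Qed.
Lemma lieDr (x y z : L) : lie x (y + z) = lie x y + lie x z.
Proof. exact: linearD. Qed.
Lemma lie0l (z : L) : lie 0 z = 0.
Proof. by apply: (addIr (lie 0 z)); rewrite -lieDl !add0r. Qed.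
Lemma lie0r (z : L) : lie z 0 = 0.
Proof. exact: linear0. Qed.
Lemma lieZl a (x z : L) : lie (a *: x) z = a *: lie x z.
Proof. by have := lie_linearl z a x 0; rewrite !addr0 lie0l addr0. Qed.
Lemma lieZr a (x z : L) : lie z (a *: x) = a *: lie z x.
Proof. exact: linearZ. Qed.
Lemma lieNl (x z : L) : lie (- x) z = - lie x z.
Proof. by rewrite -scaleN1r lieZl scaleN1r. Qed.
Lemma lieNr (x z : L) : lie z (- x) = - lie z x.
Proof. exact: linearN. Qed.
Lemma lieC (x y : L) : lie x y = - lie y x.
Proof.
apply/eqP; rewrite -addr_eq0; apply/eqP.
by have := liexx (x + y); rewrite lieDl !lieDr !liexx addr0 add0r.
Qed.

End LieLinear.

Section DirectSum.
Variables (K : fieldType) (L1 L2 : lieAlgType K).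

Definition prod_lie (p q : L1 * L2) : L1 * L2 := (lie p.1 q.1, lie p.2 q.2).

Fact prod_lie_linearl q : linear (fun p => prod_lie p q).
Proof.
by move=> a x y; rewrite /prod_lie /= !lieDl !lieZl.
Qed.
Fact prod_lie_linearr p : linear (prod_lie p).
Proof. by move=> a x y; rewrite /prod_lie /= !lieDr !lieZr. Qed.
Fact prod_liexx p : prod_lie p p = 0.
Proof. by rewrite /prod_lie !liexx. Qed.
Fact prod_lie_jacobi x y z :
  prod_lie x (prod_lie y z) + prod_lie y (prod_lie z x)
    + prod_lie z (prod_lie x y) = 0.
Proof. by congr pair; rewrite /= lie_jacobi. Qed.

HB.instance Definition _ := Vector_isLieAlgebra.Build K (L1 * L2)%type
  prod_lie_linearl prod_lie_linearr prod_liexx prod_lie_jacobi.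

End DirectSum.

Section Subalgebras.
Variables (K : fieldType) (L : lieAlgType K).

Record lieSubalg := LieSubalg {
  subalg_vspace :> {vspace L};
  subalg_closed : forall x y,
    x \in subalg_vspace -> y \in subalg_vspace -> lie x y \in subalg_vspace
}.

Definition is_ideal (U : {vspace L}) :=
  forall x y, y \in U -> lie x y \in U.

Variable U : lieSubalg.

Definition sub_lie (x y : subvs_of U) : subvs_of U :=
  Subvs (subalg_closed (subvsP x) (subvsP y)).

Fact sub_lie_linearl y : linear (fun x => sub_lie x y).
Proof. by move=> a u v; apply: val_inj; rewrite /= lieDl lieZl. Qed.
Fact sub_lie_linearr x : linear (sub_lie x).
Proof. by move=> a u v; apply: val_inj; rewrite /= lieDr lieZr. Qed.
Fact sub_liexx x : sub_lie x x = 0.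
Proof. by apply: val_inj; rewrite /= liexx. Qed.
Fact sub_lie_jacobi x y z :
  sub_lie x (sub_lie y z) + sub_lie y (sub_lie z x)
    + sub_lie z (sub_lie x y) = 0.
Proof. by apply: val_inj; rewrite /= lie_jacobi. Qed.

HB.instance Definition _ := Vector_isLieAlgebra.Build K (subvs_of U)
  sub_lie_linearl sub_lie_linearr sub_liexx sub_lie_jacobi.

End Subalgebras.

Section Structure.
Variables (R : realType) (L : lieAlgType R).

Definition ad (x : L) : 'End(L) := linfun (lie x).

Lemma adE x y : ad x y = lie x y.
Proof. by rewrite lfunE. Qed.

Definition lftrace (f : 'End(L)) : R :=
  \tr (passmx.mxof (vbasis {:L}) (vbasis {:L}) f).

Definition killing (x y : L) : R := lftrace (ad x \o ad y)%VF.

Definition lie_prodv (U V : {vspace L}) : {vspace L} :=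
  <<[seq lie x y | x <- vbasis U, y <- vbasis V]>>%VS.

Definition derived_series (n : nat) (U : {vspace L}) : {vspace L} :=
  iter n (fun V => lie_prodv V V) U.

Definition solvable (U : {vspace L}) :=
  exists n, derived_series n U = 0%VS.

Definition semisimple :=
  forall U : {vspace L}, is_ideal U -> solvable U -> U = 0%VS.

Definition simple :=
  (exists x y : L, lie x y <> 0) /\
  (forall U : {vspace L}, is_ideal U -> U = 0%VS \/ U = {:L}%VS).

(* Compactness of a semisimple Lie algebra; only used for semisimple [L]. *)
Definition compact_type := forall x : L, x != 0 -> killing x x < 0.

Definition complex_structure (J : 'End(L)) :=
  (forall x, J (J x) = - x) /\ (forall x y, lie (J x) y = J (lie x y)).

Definition has_complex_structure := exists J : 'End(L), complex_structure J.

End Structure.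

Arguments semisimple {R} L.
Arguments simple {R} L.
Arguments compact_type {R} L.
Arguments has_complex_structure {R} L.

Definition lie_iso (R : realType) (L L' : lieAlgType R) (f : 'Hom(L, L')) :=
  {morph f : x y / lie x y} /\ bijective f.

Definition lie_involution (R : realType) (L : lieAlgType R) (nu : 'End(L)) :=
  lie_iso nu /\ involutive nu.

Definition cartan_involution (R : realType) (L : lieAlgType R)
    (theta : 'End(L)) :=
  lie_involution theta /\ forall x, x != 0 -> 0 < - killing x (theta x).

(* Both (g0, sigma; theta) and the triads (g, theta1, theta2) give such triples,
   in this order.  The record does not ask the maps to be involutions; all the
   triples formed below are built from involutions. *)
Record triple (R : realType) := Triple {
  carrier : lieAlgType R;
  map1 : carrier -> carrier;
  map2 : carrier -> carrier
}.

Definition triple_equiv (R : realType) (T T' : triple R) :=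
  exists f : 'Hom(carrier T, carrier T'),
    [/\ lie_iso f,
        forall x, f (map1 x) = map1 (f x) &
        forall x, f (map2 x) = map2 (f x)].

Notation "T ≡ T'" := (triple_equiv T T') (at level 70, no associativity).

(* The complexification of a real Lie algebra, regarded as a real Lie algebra:
   the pair [(x, y)] stands for x + sqrt(-1) y. *)
Definition complexification (R : realType) (L : lieAlgType R) : Type :=
  (L * L)%type.

Import VectorInternalTheory.

Section Complexification.
Variables (R : realType) (L : lieAlgType R).
Local Notation LC := (complexification L).

HB.instance Definition _ := Vector.copy LC (L * L)%type.

Definition complex_lie (z w : LC) : LC :=
  (lie z.1 w.1 - lie z.2 w.2, lie z.1 w.2 + lie z.2 w.1).

Fact complex_lie_linearl w : linear (fun z => complex_lie z w).
Proof.
move=> a x y; congr pair; rewrite /= !lieDl !lieZl.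
  by rewrite scalerBr opprD addrACA.
by rewrite scalerDr addrACA.
Qed.
Fact complex_lie_linearr z : linear (complex_lie z).
Proof.
move=> a x y; congr pair; rewrite /= !lieDr !lieZr.
  by rewrite scalerBr opprD addrACA.
by rewrite scalerDr addrACA.
Qed.
Fact complex_liexx z : complex_lie z z = 0.
Proof. by congr pair; rewrite /= ?liexx ?subrr// [lie z.2 _]lieC subrr. Qed.
Fact add3_eq0 (a b c : L) : a + b + c = 0 -> c = - (a + b).
Proof. by move=> /eqP; rewrite addrC addr_eq0 => /eqP. Qed.
Fact complex_jacobi_re (a1 a2 a3 a4 b1 b2 b3 b4 c1 c2 c3 c4 : L) :
  a1 + b1 + c1 = 0 -> a2 + b4 + c3 = 0 ->
  a3 + b2 + c4 = 0 -> a4 + b3 + c2 = 0 ->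
  a1 - a2 - (a3 + a4) + (b1 - b2 - (b3 + b4)) + (c1 - c2 - (c3 + c4)) = 0.
Proof.
do 4 move=> /add3_eq0 ->.
apply: (can_inj (@v2rK R L)); rewrite !(linearD, linearN, linear0) /=.
by apply/rowP=> i; rewrite !mxE; ring.
Qed.
Fact complex_jacobi_im (a1 a2 a3 a4 b1 b2 b3 b4 c1 c2 c3 c4 : L) :
  a1 + b2 + c3 = 0 -> a2 + b3 + c1 = 0 ->
  a3 + b1 + c2 = 0 -> a4 + b4 + c4 = 0 ->
  a1 + a2 + (a3 - a4) + (b1 + b2 + (b3 - b4)) + (c1 + c2 + (c3 - c4)) = 0.
Proof.
do 4 move=> /add3_eq0 ->.
apply: (can_inj (@v2rK R L)); rewrite !(linearD, linearN, linear0) /=.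
by apply/rowP=> i; rewrite !mxE; ring.
Qed.
Fact complex_lie_jacobi x y z :
  complex_lie x (complex_lie y z) + complex_lie y (complex_lie z x)
    + complex_lie z (complex_lie x y) = 0.
Proof.
congr pair; rewrite /= !(lieDr, lieNr).
  by apply: complex_jacobi_re; apply: lie_jacobi.
by apply: complex_jacobi_im; apply: lie_jacobi.
Qed.

HB.instance Definition _ := Vector_isLieAlgebra.Build R LC
  complex_lie_linearl complex_lie_linearr complex_liexx complex_lie_jacobi.

Lemma complex_lieE (z w : LC) :
  lie z w = (lie z.1 w.1 - lie z.2 w.2, lie z.1 w.2 + lie z.2 w.1) :> LC.
Proof. by []. Qed.

(* Multiplication by sqrt(-1). *)
Definition mulI (z : LC) : LC := (- z.2, z.1).

Definition real_emb (x : L) : LC := (x, 0).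

(* x |-> sqrt(-1) x *)
Definition imag_emb (x : L) : LC := mulI (real_emb x).

(* The C-linear extension of f. *)
Definition complex_ext (f : L -> L) (z : LC) : LC := (f z.1, f z.2).

Fact real_emb_linear : linear real_emb.
Proof. by move=> a x y; congr pair; rewrite /= scaler0 addr0. Qed.
HB.instance Definition _ := GRing.isLinear.Build R L LC _ real_emb
  real_emb_linear.

Fact imag_emb_linear : linear imag_emb.
Proof. by move=> a x y; congr pair; rewrite /= !oppr0 scaler0 addr0. Qed.
HB.instance Definition _ := GRing.isLinear.Build R L LC _ imag_emb
  imag_emb_linear.

End Complexification.

Record symmetricPair (R : realType) := SymmetricPair {
  g0 :> lieAlgType R;
  sigma : 'End(g0);
  theta : 'End(g0);
  g0_semisimple : semisimple g0;
  g0_noncompact : ~ compact_type g0;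
  sigma_involution : lie_involution sigma;
  theta_cartan : cartan_involution theta;
  theta_sigma : forall x, theta (sigma x) = sigma (theta x)
}.

Definition triple_of (R : realType) (P : symmetricPair R) : triple R :=
  Triple (sigma P) (theta P).

Definition irreducible (R : realType) (P : symmetricPair R) :=
  forall U : {vspace P}, is_ideal U -> (sigma P @: U <= U)%VS ->
    U = 0%VS \/ U = {:P}%VS.

Section Dual.
Variables (R : realType) (P : symmetricPair R).
Local Notation LC := (complexification P).
Local Notation sg := (sigma P).
Local Notation th := (theta P).

Definition dual_vspace : {vspace LC} :=
  (linfun (@real_emb R P) @: passmx.leigenspace th 1
   + linfun (@imag_emb R P) @: passmx.leigenspace th (-1))%VS.

Lemma dual_vspaceP z :
  reflect (th z.1 = z.1 /\ th z.2 = - z.2) (z \in dual_vspace).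
Proof.
have eigE a x : (x \in passmx.leigenspace th a) = (th x == a *: x).
  by rewrite memv_ker !lfunE /= opp_lfunE scale_lfunE id_lfunE subr_eq0.
apply: (iffP memv_addP).
  move=> [_ /memv_imgP[x xk ->] [_ /memv_imgP[y yp ->] ->]].
  move: xk yp; rewrite !eigE !lfunE /= scale1r scaleN1r => /eqP xk /eqP yp.
  by rewrite /= oppr0 addr0 add0r.
case: z => x y [/= xk yp]; exists (linfun (@real_emb R P) x).
  by rewrite memv_img// eigE scale1r xk.
exists (linfun (@imag_emb R P) y); first by rewrite memv_img// eigE scaleN1r yp.
by rewrite !lfunE; congr pair; rewrite /= ?oppr0 ?addr0 ?add0r.
Qed.

Fact dual_closed x y :
  x \in dual_vspace -> y \in dual_vspace -> lie x y \in dual_vspace.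
Proof.
have [[[thM _] _] _] := theta_cartan P.
move=> /dual_vspaceP[x1 x2] /dual_vspaceP[y1 y2]; apply/dual_vspaceP.
rewrite /= !(linearD, linearN) /= !thM x1 x2 y1 y2.
by rewrite !(lieNl, lieNr) opprK.
Qed.

Definition dual_alg : lieSubalg LC := LieSubalg dual_closed.

End Dual.

(* The restriction to [U] of a map preserving [U]. *)
Definition restr (K : fieldType) (V : vectType K) (U : {vspace V})
    (f : V -> V) (x : subvs_of U) : subvs_of U := vsproj U (f (vsval x)).

Lemma restrE (K : fieldType) (V : vectType K) (U : {vspace V}) (f : V -> V) :
  {homo f : x / x \in U} -> forall x, vsval (restr f x : subvs_of U) = f (vsval x).
Proof. by move=> fU x; rewrite /restr vsprojK ?fU ?subvsP. Qed.

Definition dual (R : realType) (P : symmetricPair R) : triple R :=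
  @Triple R (subvs_of (dual_alg P))
    (restr (complex_ext (theta P))) (restr (complex_ext (sigma P))).

Lemma dual_theta (R : realType) (P : symmetricPair R) (x : carrier (dual P)) :
  vsval (map1 x) = complex_ext (theta P) (vsval x).
Proof.
apply: restrE => {x} z /dual_vspaceP[z1 z2].
by apply/dual_vspaceP; rewrite /= z1 z2 linearN /= z2.
Qed.

Lemma dual_sigma (R : realType) (P : symmetricPair R) (x : carrier (dual P)) :
  vsval (map2 x) = complex_ext (sigma P) (vsval x).
Proof.
apply: restrE => {x} z /dual_vspaceP[z1 z2].
by apply/dual_vspaceP; rewrite /= !theta_sigma z1 z2 linearN.
Qed.

Definition rho (L : Type) (p : L * L) : L * L := (p.2, p.1).

Definition oplus (L1 L2 : Type) (f : L1 -> L1) (g : L2 -> L2) (p : L1 * L2) :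
  L1 * L2 := (f p.1, g p.2).

Definition rho_12_34 (L : Type) (p : L * L * L * L) : L * L * L * L :=
  let: (x, y, z, w) := p in (y, x, w, z).

Definition rho_14_23 (L : Type) (p : L * L * L * L) : L * L * L * L :=
  let: (x, y, z, w) := p in (w, z, y, x).

Section PairTypes.
Variables (R : realType) (P : symmetricPair R).
Local Notation sg := (sigma P).
Local Notation th := (theta P).

Definition P_a := simple P /\
  exists J : 'End(P), complex_structure J /\ forall x, sg (J x) = - J (sg x).

Definition P_b := simple P /\
  exists J : 'End(P), complex_structure J /\ forall x, sg (J x) = J (sg x).

Definition doubled (U : lieSubalg P) : triple R :=
  @Triple R (subvs_of U * subvs_of U)%type
    (@rho (subvs_of U)) (oplus (restr th) (restr th)).

Definition P_c := exists U : lieSubalg P,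
  [/\ is_ideal U, (th @: U <= U)%VS, simple (subvs_of U),
      has_complex_structure (subvs_of U) & triple_of P ≡ doubled U].

Definition P_d := exists U : lieSubalg P,
  [/\ is_ideal U, (th @: U <= U)%VS, simple (subvs_of U),
      ~ has_complex_structure (subvs_of U) & triple_of P ≡ doubled U].

End PairTypes.

Section TriadTypes.
Variables (R : realType) (T : triple R).

Definition compact_simple (u : lieAlgType R) := simple u /\ compact_type u.

Definition T_a := exists2 u : lieAlgType R, compact_simple u &
  exists2 nu : 'End(u), lie_involution nu &
    T ≡ @Triple R (u * u)%type (@rho u) (@rho u \o oplus nu nu).

Definition T_b := exists2 u : lieAlgType R, compact_simple u &
  exists2 nu : 'End(u), lie_involution nu &
    T ≡ @Triple R (u * u)%type (@rho u) (oplus nu nu).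

Definition T_c := exists2 u : lieAlgType R, compact_simple u &
  T ≡ @Triple R (u * u * u * u)%type (@rho_12_34 u) (@rho_14_23 u).

Definition T_d := exists2 u : lieAlgType R, compact_simple u &
  exists2 nu : 'End(u), lie_involution nu &
    T ≡ @Triple R (u * u)%type (oplus nu nu) (@rho u).

End TriadTypes.

(* Main.v *)
Require Import Defs.
From mathcomp Require Import all_boot all_order all_algebra.
From mathcomp Require Import reals.
From HB Require Import structures.
From mathcomp Require Import ring.

Set Implicit Arguments.
Unset Strict Implicit.
Unset Printing Implicit Defensive.

Import Order.TTheory GRing.Theory Num.Theory.
Local Open Scope ring_scope.

(** Every one of the eight types is decided by the centroid, the algebra of
    linear maps A with A [x, y] = [A x, y].  On the side of the pair, a complex
    structure is a centroid element of square -1, and a splitting of g0 into an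
    ideal and its image under sigma is a centroid element of square 1 that
    anticommutes with sigma, namely the difference of the two projections.  The
    four types say which of these exist and how they commute with sigma
    ([P_aP], [P_bP], [P_cP], [P_dP]).  On the side of the dual, a decomposition
    of the compact algebra into ideals exchanged by theta or sigma is again a
    centroid element of square 1, with signs against theta and sigma
    ([T_aP], [T_bP], [T_cP], [T_dP]).

    The two sides are compared in [dual_has_centroid].  The bracket of the dual
    differs from that of g0 only by a sign on pairs of (-1)-eigenvectors of
    theta, so a centroid element that commutes with theta is one for both
    brackets, while J in the centroid of g0 with J theta = - theta J gives
    J theta in the centroid of the dual.  It has square +1 when J has square
    -1: it is the product of the two complex structures of the complexification
    and its eigenspaces cut the dual in two.  What makes this exhaustive is
    [centroid_theta]: in an irreducible pair a centroid element A of square 1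
    (resp. -1) with a sign against sigma commutes (resp. anticommutes) with
    theta, because theta A theta is the adjoint of A for the positive definite
    form - B(x, theta y), so theta A theta A can only be the identity.

    Conversely, a centroid involution E that anticommutes with an involutive
    automorphism tau splits the algebra as U + tau U with U = ker (E - 1)
    ([split_iso]), and a proper ideal of U would produce one more centroid
    involution ([no_ideal_fixed]), which the exclusion clause of the type
    forbids; this makes the summands simple.  The dual is compact since its
    Killing form at the image of x is B(x, theta x) ([killing_to_dual]). *)

(** * The trace and the Killing form *)

Section Trace.
Variables (R : realType) (L M : lieAlgType R).

(** Between two different spaces this is what makes the trace independent of
    the basis in its definition, and it reduces the trace of an endomorphism
    that factors through a subspace to a trace on that subspace. *)
Lemma lftrace_cyclic (f : 'Hom(L, M)) (g : 'Hom(M, L)) :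
  lftrace (g \o f)%VF = lftrace (f \o g)%VF.
Proof.
rewrite /lftrace (passmx.mxof_comp _ _ (vbasisP {:M})).
by rewrite (passmx.mxof_comp _ _ (vbasisP {:L})) mxtrace_mulC.
Qed.

Fact lftrace_linear : linear_for *%R (@lftrace R L).
Proof.
move=> a f g; rewrite /lftrace.
rewrite (passmx.mxof_linear (vbasis {:L}) (vbasis {:L}) a f g).
by rewrite mxtraceD mxtraceZ.
Qed.
HB.instance Definition _ :=
  GRing.isLinear.Build R 'End(L) R *%R (@lftrace R L) lftrace_linear.

End Trace.

Section Killing.
Variables (R : realType) (L : lieAlgType R).

Lemma killing_central (x y : L) : (forall z, lie x z = 0) -> killing x y = 0.
Proof.
move=> xZ; rewrite /killing; have -> : ad x = 0.
  by apply/lfunP => z; rewrite adE xZ zero_lfunE.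
by rewrite comp_lfun0l linear0.
Qed.

Lemma killingNr (x y : L) : killing x (- y) = - killing x y.
Proof.
rewrite /killing; have -> : ad (- y) = - ad y.
  by apply/lfunP => z; rewrite opp_lfunE !adE lieNl.
by rewrite comp_lfunNr linearN.
Qed.

End Killing.

(** * The centroid *)

Section Centroid.
Variables (R : realType) (L : lieAlgType R).
Implicit Types (A B E : 'End(L)) (V W : {vspace L}).

Lemma half_neq0 : 2 != 0 :> R.
Proof. by rewrite pnatr_eq0. Qed.

Lemma eq_opp0 (x : L) : x = - x -> x = 0.
Proof.
move=> /eqP; rewrite -addr_eq0 -mulr2n -scaler_nat scaler_eq0 (negPf half_neq0).
by move/eqP.
Qed.

Lemma half_sumK (x y : L) : 2^-1 *: (x + y + (x - y)) = x.
Proof.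
rewrite addrACA subrr addr0 -mulr2n -scaler_nat scalerA mulVf ?half_neq0//.
exact: scale1r.
Qed.

Definition centroid A := forall x y, A (lie x y) = lie (A x) y.

Lemma centroidr A : centroid A -> forall x y, A (lie x y) = lie x (A y).
Proof. by move=> cA x y; rewrite lieC linearN /= cA -lieC. Qed.

Lemma centroid_comp A B : centroid A -> centroid B -> centroid (A \o B)%VF.
Proof. by move=> cA cB x y; rewrite !comp_lfunE cB cA. Qed.

Definition centerless := forall x : L, (forall y, lie x y = 0) -> x = 0.

(** Both A B [x, y] and B A [x, y] equal [A x, B y], so the commutator of A and
    B sends every x into the centre. *)
Lemma centroidC A B : centerless -> centroid A -> centroid B ->
  forall x, A (B x) = B (A x).
Proof.
move=> Z cA cB x; apply/eqP; rewrite -subr_eq0; apply/eqP/Z => y.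
have ABxy : lie (A (B x)) y = lie (A x) (B y).
  by rewrite -cA -cB (centroidr cB) cA.
by rewrite lieDl lieNl ABxy -cB (centroidr cB) subrr.
Qed.

Lemma killing_centroid A x y : centroid A -> killing (A x) y = killing x (A y).
Proof.
move=> cA; rewrite /killing.
have -> : ad (A x) = (A \o ad x)%VF.
  by apply/lfunP => z; rewrite !lfunE/= lfunE/= cA.
have -> : ad (A y) = (ad y \o A)%VF.
  by apply/lfunP => z; rewrite !lfunE/= lfunE/= -cA centroidr.
by rewrite -comp_lfunA lftrace_cyclic comp_lfunA.
Qed.

(** Two maps cover all the cases below: both involutions for the dual, one
    involution and the identity for a symmetric pair or for a summand of the
    dual, and twice the identity for the absence of proper ideals. *)
Definition irreducible_under (tau nu : L -> L) := forall V, is_ideal V ->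
  {homo tau : x / x \in V} -> {homo nu : x / x \in V} -> V = 0%VS \/ V = fullv.

Lemma fixed_ideal E : centroid E -> is_ideal (fixedSpace E).
Proof.
by move=> cE x y /fixedSpaceP yE; apply/fixedSpaceP; rewrite centroidr ?yE.
Qed.

Lemma irreducible_centroid_sign (tau nu : L -> L) Q :
  irreducible_under tau nu -> centroid Q -> involutive Q ->
  (forall x, Q (tau x) = tau (Q x)) -> (forall x, Q (nu x) = nu (Q x)) ->
  (forall x, Q x = x) \/ (forall x, Q x = - x).
Proof.
move=> irrL cQ QK Qtau Qnu.
have [x /fixedSpaceP Qx|x /fixedSpaceP Qx|F0|FT] := irrL _ (fixed_ideal cQ).
- by apply/fixedSpaceP; rewrite Qtau Qx.
- by apply/fixedSpaceP; rewrite Qnu Qx.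
- right=> x; apply/eqP; rewrite -addr_eq0 -memv0 -F0; apply/fixedSpaceP.
  by rewrite linearD /= QK addrC.
- by left=> x; apply/fixedSpaceP; rewrite FT memvf.
Qed.

(** Exactly the centroid elements that [centroid_of_ideal] constructs, with the
    two maps exchanged. *)
Definition no_anti_centroid (tau mu : L -> L) :=
  ~ exists A, [/\ centroid A, involutive A, forall x, A (tau x) = tau (A x)
                & forall x, A (mu x) = - mu (A x)].

Lemma no_anti_centroid1 tau :
  (exists x : L, x <> 0) -> no_anti_centroid tau (\1%VF : 'End(L)).
Proof.
move=> [x x0] [A [_ AK _ AN]]; apply: x0; rewrite -[x]AK.
by apply: eq_opp0; rewrite -{1}[A x]id_lfunE AN id_lfunE.
Qed.

Lemma lie_involutionI (f : 'End(L)) :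
  {morph f : x y / lie x y} -> involutive f -> lie_involution f.
Proof. by move=> fM fK; split=> //; split=> //; exists f. Qed.

Lemma lie_involution1 : lie_involution (\1%VF : 'End(L)).
Proof. by apply: lie_involutionI => [x y|x]; rewrite !id_lfunE. Qed.

(** By irreducibility the ideals W and tau W meet in 0 and span the algebra; E
    is the projection to W minus the projection to tau W. *)
Lemma centroid_of_ideal (tau nu : 'End(L)) W : irreducible_under tau nu ->
  lie_involution tau -> (forall x, tau (nu x) = nu (tau x)) ->
  is_ideal W -> {homo nu : x / x \in W} -> W <> 0%VS -> W <> fullv ->
  exists E, [/\ centroid E, involutive E, forall x, E (tau x) = - tau (E x)
              & forall x, E (nu x) = nu (E x)].
Proof.
move=> irrL [[tauM _] tauK] taunu iW nuW W0 WT; pose W' := (tau @: W)%VS.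
have inW' x : (x \in W') = (tau x \in W).
  apply/memv_imgP/idP => [[u uW ->]|]; first by rewrite tauK.
  by exists (tau x); rewrite ?tauK.
have iW' : is_ideal W' by move=> x y; rewrite !inW' tauM; apply: iW.
have nuW' x : x \in W' -> nu x \in W' by rewrite !inW' taunu; apply: nuW.
have [x y|x|x|cap0|capT] := irrL (W :&: W')%VS.
- by rewrite !memv_cap => /andP[? ?]; rewrite iW// iW'.
- by rewrite !memv_cap !inW' tauK andbC.
- by rewrite !memv_cap => /andP[? ?]; rewrite nuW// nuW'.
- have [x y /memv_addP[u uW [v vW' ->]]|_ /memv_addP[u uW [v vW' ->]]|
    _ /memv_addP[u uW [v vW' ->]]|add0|addT] := irrL (W + W')%VS.
  + by rewrite lieDr memv_add ?iW ?iW'.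
  + by rewrite linearD/= addrC memv_add// ?inW' ?tauK// -inW'.
  + by rewrite linearD/= memv_add ?nuW ?nuW'.
  + by case: W0; apply/eqP; rewrite -subv0 -add0 addvSl.
  pose E : 'End(L) := daddv_pi W W' - daddv_pi W' W.
  have cap0' : (W' :&: W = 0)%VS by rewrite capvC.
  have dec z : exists u v, [/\ u \in W, v \in W' & z = u + v].
    have : z \in (W + W')%VS by rewrite addT memvf.
    by case/memv_addP => u uW [v vW' ->]; exists u, v.
  have EE u v : u \in W -> v \in W' -> E (u + v) = u - v.
    move=> uW vW'; rewrite /E add_lfunE opp_lfunE !linearD /=.
    have uA : u \in (W + W')%VS by rewrite addT memvf.
    have vA : v \in (W' + W)%VS by rewrite addvC addT memvf.
    have := daddv_pi_add cap0 uA; have := daddv_pi_add cap0' vA.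
    rewrite (daddv_pi_id cap0 uW) (daddv_pi_id cap0' vW').
    move=> /(canRL (addKr _)) ->; move=> /(canRL (addKr _)) ->.
    by rewrite !addNr addr0 oppr0 sub0r.
  exists E; split=> [x y|x|x|x].
  + have [u [v [uW vW' ->]]] := dec x.
    by rewrite lieDl !EE ?lieDl ?lieNl// lieC memvN ?iW ?iW'.
  + have [u [v [uW vW' ->]]] := dec x.
    by rewrite EE// EE ?memvN// opprK.
  + have [u [v [uW vW' ->]]] := dec x.
    rewrite EE// [tau (u + v)]linearD /= addrC EE -?inW'// ?inW' ?tauK//.
    by rewrite linearD linearN /= opprD opprK addrC.
  + have [u [v [uW vW' ->]]] := dec x.
    by rewrite EE// [nu (u + v)]linearD EE ?nuW ?nuW'//= linearD linearN.
by case: WT; apply/eqP; rewrite eqEsubv subvf -capT capvSl.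
Qed.

End Centroid.

Definition restr_lfun (R : realType) (V : vectType R) (U : {vspace V})
    (f : 'End(V)) : 'End(subvs_of U) :=
  (linfun (vsproj U) \o (f \o linfun (@vsval R V U)))%VF.

Lemma restr_lfunE (R : realType) (V : vectType R) (U : {vspace V}) (f : 'End(V)) :
  restr_lfun U f =1 restr f.
Proof. by move=> x; rewrite !lfunE /= !lfunE /= lfunE. Qed.

Lemma compact_centerless (R : realType) (L : lieAlgType R) :
  compact_type L -> centerless L.
Proof.
move=> cL x xZ; apply/eqP/negPn/negP => /cL.
by rewrite killing_central// ltxx.
Qed.

(** * Splitting along a centroid involution *)

Section Splitting.
Variables (R : realType) (L : lieAlgType R) (E tau : 'End(L)).
Hypotheses (cE : centroid E) (EK : involutive E).

(** The (+1)-eigenspace of a centroid element is an ideal. *)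
Definition fixed_alg : lieSubalg L :=
  LieSubalg (fun x y _ yU => fixed_ideal cE x yU).
Local Notation U := (subvs_of fixed_alg).

Lemma restr_lfun_fixedE (f : 'End(L)) : (forall x, E (f x) = f (E x)) ->
  forall u : U, vsval (restr_lfun fixed_alg f u) = f (vsval u).
Proof.
move=> Ef u; rewrite restr_lfunE restrE// => z /fixedSpaceP Ez.
by apply/fixedSpaceP; rewrite Ef Ez.
Qed.

Lemma fixed_algE (u : U) : E (vsval u) = vsval u.
Proof. by apply/fixedSpaceP; apply: subvsP. Qed.

Definition fixed_part x := 2^-1 *: (x + E x).

Lemma fixed_partP x : fixed_part x \in fixedSpace E.
Proof. by apply/fixedSpaceP; rewrite linearZ linearD /= EK addrC. Qed.

Definition fixed_proj x : U := Subvs (fixed_partP x).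

Lemma fixed_part_id x : x \in fixedSpace E -> fixed_part x = x.
Proof.
move=> /fixedSpaceP Ex; rewrite /fixed_part Ex -mulr2n -scaler_nat scalerA.
by rewrite mulVf ?half_neq0// scale1r.
Qed.

(** The fixed ideal commutes with the (-1)-eigenspace of E. *)
Lemma lie_fixed_part x y : x \in fixedSpace E -> lie x (fixed_part y) = lie x y.
Proof.
move=> /fixedSpaceP Ex; rewrite /fixed_part lieZr lieDr -(centroidr cE) cE Ex.
by rewrite -mulr2n -scaler_nat scalerA mulVf ?half_neq0// scale1r.
Qed.

(** The square of ad u factors through the fixed ideal, since the
    complementary ideal commutes with u; only the trace on that ideal is
    left. *)
Lemma killing_fixed (u : U) : killing u u = killing (vsval u) (vsval u).
Proof.
pose pi : 'Hom(L, U) := (linfun (vsproj fixed_alg) \o (2^-1 *: (\1 + E)))%VF.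
pose iota : 'Hom(U, L) := linfun (@vsval _ _ fixed_alg).
have piE x : vsval (pi x) = fixed_part x.
  by rewrite comp_lfunE lfunE scale_lfunE add_lfunE id_lfunE vsprojK ?fixed_partP.
have piK : (pi \o iota)%VF = \1%VF.
  apply/lfunP => x; rewrite comp_lfunE id_lfunE; apply: val_inj.
  by rewrite [LHS]piE lfunE /= fixed_part_id ?subvsP.
have ad2E : (ad (vsval u) \o ad (vsval u) = iota \o ((ad u \o ad u) \o pi))%VF.
  apply/lfunP => x; rewrite 3!comp_lfunE /= !adE [RHS]lfunE /= comp_lfunE !adE /= piE.
  by rewrite lie_fixed_part ?subvsP.
by rewrite /killing ad2E -lftrace_cyclic -comp_lfunA piK comp_lfun1r.
Qed.

Lemma compact_fixed : compact_type L -> compact_type U.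
Proof.
move=> cL u u0; rewrite killing_fixed; apply: cL; apply: contra_neq u0 => u0.
exact: val_inj.
Qed.

Lemma centerless_fixed : centerless L -> centerless U.
Proof.
move=> ZL u uZ; apply: val_inj; apply: ZL => y.
rewrite -lie_fixed_part ?subvsP//.
by have /(congr1 val) := uZ (fixed_proj y).
Qed.

(** A vector acts on the fixed ideal through its component in it, so an ideal of
    the fixed ideal is an ideal of the whole algebra. *)
Lemma lift_ideal (V : {vspace U}) :
  is_ideal V -> is_ideal (linfun (@vsval _ _ fixed_alg) @: V)%VS.
Proof.
move=> iV x _ /memv_imgP[v vV ->]; apply/memv_imgP.
exists (lie (fixed_proj x) v); first exact: iV.
by rewrite !lfunE /= lieC -lie_fixed_part ?subvsP// -lieC.
Qed.

Hypotheses (tauI : lie_involution tau) (Etau : forall x, E (tau x) = - tau (E x)).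

Let tauM : {morph tau : x y / lie x y} := tauI.1.1.
Let tauK : involutive tau := tauI.2.

Section DoubleIdeal.
Variables (V : {vspace U}) (iV : is_ideal V).
Let V1 : {vspace L} := (linfun (@vsval _ _ fixed_alg) @: V)%VS.

(** The smallest tau-stable ideal that contains V. *)
Definition double_ideal : {vspace L} := (V1 + tau @: V1)%VS.

Lemma double_idealP : is_ideal double_ideal.
Proof.
move=> x y /memv_addP[v vV [_ /memv_imgP[w wV ->] ->]].
rewrite lieDr memv_add ?lift_ideal//; apply/memv_imgP; exists (lie (tau x) w).
  exact: lift_ideal.
by rewrite tauM tauK.
Qed.

Lemma double_ideal_tau : {homo tau : x / x \in double_ideal}.
Proof.
move=> _ /memv_addP[v vV [_ /memv_imgP[w wV ->] ->]].
by rewrite linearD /= tauK addrC memv_add ?memv_img.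
Qed.

Lemma double_ideal_stable (nu : 'End(L)) : (forall x, tau (nu x) = nu (tau x)) ->
  (forall x, E (nu x) = nu (E x)) ->
  {homo (restr nu : U -> U) : x / x \in V} -> {homo nu : x / x \in double_ideal}.
Proof.
move=> taunu Enu nuV.
have nuV1 x : x \in V1 -> nu x \in V1.
  move=> /memv_imgP[v vV ->]; rewrite lfunE /= -restrE.
    by rewrite -(lfunE (@vsval _ _ fixed_alg)) memv_img ?nuV.
  by move=> z /fixedSpaceP Ez; apply/fixedSpaceP; rewrite Enu Ez.
move=> _ /memv_addP[v vV [_ /memv_imgP[w wV ->] ->]].
by rewrite linearD /= -taunu memv_add ?memv_img ?nuV1.
Qed.

Lemma double_ideal0 : double_ideal = 0%VS -> V = 0%VS.
Proof.
move=> D0; apply/eqP; rewrite -subv0; apply/subvP => v vV; rewrite memv0.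
have : vsval v \in double_ideal.
  rewrite -[vsval v]addr0 memv_add ?mem0v//.
  by rewrite -(lfunE (@vsval _ _ fixed_alg)) memv_img.
by rewrite D0 memv0.
Qed.

Lemma double_idealT : double_ideal = fullv -> V = fullv.
Proof.
move=> DT; apply/eqP; rewrite eqEsubv subvf; apply/subvP => u _.
have : vsval u \in double_ideal by rewrite DT memvf.
move=> /memv_addP[_ /memv_imgP[v vV ->] [_ /memv_imgP[_ /memv_imgP[w wV ->] ->]]].
rewrite !lfunE /= => uE; suff <- : v = u by [].
have tw0 : tau (vsval w) = 0.
  apply: eq_opp0; rewrite -{2}(fixed_algE w) -Etau.
  have -> : tau (vsval w) = vsval (u - v) by rewrite /= uE addrC addKr.
  by rewrite fixed_algE.
by apply: val_inj; rewrite /= uE tw0 addr0.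
Qed.

End DoubleIdeal.

Lemma irreducible_fixed (nu : 'End(L)) : irreducible_under tau nu ->
  (forall x, tau (nu x) = nu (tau x)) -> (forall x, E (nu x) = nu (E x)) ->
  irreducible_under (restr nu : U -> U) id.
Proof.
move=> irrL taunu Enu V iV nuV _.
have [D0|DT] := irrL _ (double_idealP iV) (@double_ideal_tau V)
  (double_ideal_stable taunu Enu nuV).
  by left; apply: double_ideal0.
by right; apply: double_idealT.
Qed.

(** A proper ideal V of the fixed ideal gives the proper tau-stable ideal
    V + tau V.  Applied to it, [centroid_of_ideal] with mu in the role of the
    exchanging automorphism gives a centroid involution that the hypothesis
    excludes. *)
Lemma no_ideal_fixed (mu : 'End(L)) : irreducible_under tau mu -> lie_involution mu ->
  (forall x, mu (tau x) = tau (mu x)) ->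
  no_anti_centroid tau mu ->
  forall V : {vspace U}, is_ideal V -> V = 0%VS \/ V = fullv.
Proof.
move=> irrL muI mutau noA V iV.
have [D0|D0] := eqVneq (double_ideal V) 0%VS; first by left; apply: double_ideal0.
have [DT|DT] := eqVneq (double_ideal V) fullv; first by right; apply: double_idealT.
case: noA; have [] := @centroid_of_ideal _ _ mu tau (double_ideal V) _ muI mutau
  (double_idealP iV) (@double_ideal_tau V); [|exact/eqP|exact/eqP|].
  by move=> W iW muW tauW; apply: irrL.
by move=> A [cA AK Amu Atau]; exists A.
Qed.

Definition split_fun (p : U * U) : L := vsval p.1 + tau (vsval p.2).

Fact split_fun_linear : linear split_fun.
Proof.
by move=> a p q; rewrite /split_fun scalerDr addrACA /= !linearP.
Qed.
HB.instance Definition _ := GRing.isLinear.Build R (U * U)%type L _ split_fun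
  split_fun_linear.

Definition split_map : 'Hom((U * U)%type, L) := linfun split_fun.

Lemma split_mapE p : split_map p = vsval p.1 + tau (vsval p.2).
Proof. exact: lfunE. Qed.

(** E is 1 on the fixed ideal and -1 on its image under tau, so the bracket of
    two vectors from them equals its own opposite. *)
Lemma lie_fixed_tau x y : x \in fixedSpace E -> y \in fixedSpace E ->
  lie x (tau y) = 0.
Proof.
move=> /fixedSpaceP Ex /fixedSpaceP Ey; apply: eq_opp0.
by rewrite -lieNr -{2}Ey -Etau -(centroidr cE) cE Ex.
Qed.

Lemma fixed_part_tau z : fixed_part z + tau (fixed_part (tau z)) = z.
Proof.
rewrite /fixed_part [tau (_ *: _)]linearZ /= [tau (_ + _)]linearD /= Etau linearN /= !tauK.
by rewrite -scalerDr half_sumK.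
Qed.

(** The algebra is the direct sum of the fixed ideal and its image under tau;
    the model U x U carries tau as the exchange of factors. *)
Lemma split_iso : lie_iso split_map.
Proof.
split=> [p q|].
  rewrite !split_mapE /= lieDl !lieDr tauM (lie_fixed_tau (subvsP p.1) (subvsP q.2)).
  rewrite [lie (tau _) (vsval q.1)]lieC (lie_fixed_tau (subvsP q.1) (subvsP p.2)).
  by rewrite oppr0 addr0 add0r.
exists (fun z => (vsproj fixed_alg (fixed_part z),
                  vsproj fixed_alg (fixed_part (tau z)))) => [p|z].
  case: p => x y; rewrite split_mapE /= linearD /= tauK.
  have Ft u v : fixed_part (vsval (u : U) + tau (vsval (v : U))) = vsval u.
    by rewrite /fixed_part [E _]linearD /= Etau !fixed_algE half_sumK.
  by rewrite [tau _ + _]addrC !Ft !vsvalK.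
by rewrite split_mapE /= !vsprojK ?fixed_partP// fixed_part_tau.
Qed.

Lemma split_map_rho p : split_map (rho p) = tau (split_map p).
Proof. by rewrite !split_mapE linearD /= tauK addrC. Qed.

Lemma split_map_oplus (nu : 'End(L)) p : (forall x, tau (nu x) = nu (tau x)) ->
  (forall x, E (nu x) = nu (E x)) ->
  split_map (oplus (restr nu) (restr nu) p) = nu (split_map p).
Proof.
move=> taunu Enu; rewrite !split_mapE linearD /= !restrE ?taunu//.
all: by move=> z /fixedSpaceP Ez; apply/fixedSpaceP; rewrite Enu Ez.
Qed.

Lemma fixed_neq0 : (exists x : L, x <> 0) -> exists u : U, u <> 0.
Proof.
move=> [x x0]; have [Fx|] := eqVneq (fixed_part x) 0; last first.
  by move=> Fx; exists (fixed_proj x) => /(congr1 val) /= /eqP; rewrite (negPf Fx).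
exists (fixed_proj (tau x)) => /(congr1 val) /= Ftx; apply: x0.
by rewrite -[x]fixed_part_tau Fx Ftx linear0 addr0.
Qed.

End Splitting.

(** * Equivalence of triples and the centroid signs *)

Section Triples.
Variable R : realType.
Implicit Types T : triple R.

Lemma lie_iso_inv (L M : lieAlgType R) (f : 'Hom(L, M)) : lie_iso f ->
  exists g : 'Hom(M, L), [/\ lie_iso g, cancel f g & cancel g f].
Proof.
move=> [fM [g fK gK]].
pose gL := GRing.isLinear.Build R M L _ g (can2_linear fK gK).
pose g' : {linear M -> L} := HB.pack g gL.
have gE : linfun g' =1 g by exact: lfunE.
exists (linfun g'); split=> [|x|x]; try by rewrite gE.
split=> [x y|]; first by rewrite !gE -{1}[x]gK -{1}[y]gK -fM fK.
by exists f => x; rewrite gE.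
Qed.

Lemma triple_equiv_sym T T' : T ≡ T' -> T' ≡ T.
Proof.
move=> [f [/lie_iso_inv[g [gI fK gK]] f1 f2]]; exists g; split=> // x.
  by apply: (can_inj fK); rewrite f1 !gK.
by apply: (can_inj fK); rewrite f2 !gK.
Qed.

Lemma triple_equiv_trans T T' T'' : T ≡ T' -> T' ≡ T'' -> T ≡ T''.
Proof.
move=> [f [[fM fB] f1 f2]] [g [[gM gB] g1 g2]]; exists (g \o f)%VF.
split=> [|x|x]; rewrite ?comp_lfunE ?f1 ?f2 ?g1 ?g2//.
split=> [x y|]; first by rewrite !comp_lfunE fM gM.
by apply: (eq_bij (bij_comp gB fB)) => x; rewrite /= comp_lfunE.
Qed.

(** The sign c tells a splitting (c = 1) from a complex structure (c = -1), and
    s, t record how it behaves under the two maps of the triple. *)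
Definition has_centroid T (c s t : R) := exists A : 'End(carrier T),
  [/\ centroid A, forall x, A (A x) = c *: x,
      forall x, A (map1 x) = s *: map1 (A x)
    & forall x, A (map2 x) = t *: map2 (A x)].

Lemma has_centroid_equiv T T' c s t :
  T ≡ T' -> has_centroid T c s t -> has_centroid T' c s t.
Proof.
move=> /[dup] /triple_equiv_sym[_ _] [f [fI f1 f2]].
have [g [[gM _] fK gK]] := lie_iso_inv fI; have [fM _] := fI.
have g1 y : g (map1 y) = map1 (g y) by apply: (can_inj fK); rewrite gK f1 gK.
have g2 y : g (map2 y) = map2 (g y) by apply: (can_inj fK); rewrite gK f2 gK.
move=> [A [cA AA A1 A2]]; exists (f \o (A \o g))%VF.
split=> x; rewrite ?comp_lfunE.
- by move=> y; rewrite !comp_lfunE gM cA fM gK.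
- by rewrite fK AA linearZ /= gK.
- by rewrite g1 A1 linearZ /= f1.
- by rewrite g2 A2 linearZ /= f2.
Qed.

Lemma centerless_simple (L : lieAlgType R) : centerless L ->
  (exists x : L, x <> 0) ->
  (forall V : {vspace L}, is_ideal V -> V = 0%VS \/ V = fullv) -> simple L.
Proof.
move=> ZL [x x0] irrL; split=> //; exists x.
have : ad x != 0.
  by apply/eqP => adx0; case: x0; apply: ZL => y; rewrite -adE adx0 zero_lfunE.
by case/lfunPn => y; rewrite zero_lfunE adE => /eqP; exists y.
Qed.

Lemma sign_antiE (L : lieAlgType R) (A : 'End(L)) (g : L -> L) :
  {morph g : x / - x} -> (forall x, g x = 0 -> x = 0) ->
  (forall x, A x = x) \/ (forall x, A x = - x) ->
  (forall x, A (g x) = -1 *: g (A x)) -> forall x : L, x = 0.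
Proof.
move=> gN g0 Asign Ag x; apply/g0/eq_opp0.
by move: (Ag x); rewrite scaleN1r; case: Asign => AE; rewrite !AE // gN opprK.
Qed.

Section Doubled.
Variable u : lieAlgType R.

(** A (x, 0) commutes with all (0, z), so its second component is central, hence
    zero; commuting with the exchange makes both diagonal entries equal. *)
Lemma centroid_rho_diag (A : 'End((u * u)%type)) : centerless u ->
  centroid A -> (forall p, A (rho p) = rho (A p)) ->
  exists2 a : 'End(u), centroid a & forall x y, A (x, y) = (a x, a y).
Proof.
move=> Zu cA Arho.
have A2 x : (A (x, 0)).2 = 0.
  apply: Zu => z; have := cA (x, 0) (0, z).
  have -> : lie ((x, 0) : u * u) (0, z) = 0 by congr pair; rewrite /= ?lie0l ?lie0r.
  by rewrite linear0 => /(congr1 snd).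
have inL : linear (fun x : u => (A (x, 0)).1).
  move=> k x y; have -> : (k *: x + y, 0) = k *: (x, 0) + (y, 0) :> u * u.
    by congr pair; rewrite /= scaler0 addr0.
  by rewrite linearP.
pose aL := GRing.isLinear.Build R u u _ _ inL.
pose a0 : {linear u -> u} := HB.pack (fun x : u => (A (x, 0)).1) aL.
pose a := linfun a0.
have aE x : A (x, 0) = (a x, 0) by rewrite /a lfunE [LHS]surjective_pairing A2.
have AE x y : A (x, y) = (a x, a y).
  have -> : (x, y) = (x, 0) + rho (y, 0) :> u * u.
    by congr pair; rewrite /= ?addr0 ?add0r.
  by rewrite linearD /= Arho !aE; congr pair; rewrite /= ?addr0 ?add0r.
exists a => // x y.
by have := cA (x, 0) (y, 0); rewrite !AE => /(congr1 fst).
Qed.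

Lemma centroid_rho_sign (A : 'End((u * u)%type)) : centerless u ->
  (forall V : {vspace u}, is_ideal V -> V = 0%VS \/ V = fullv) ->
  centroid A -> involutive A -> (forall p, A (rho p) = rho (A p)) ->
  (forall p, A p = p) \/ (forall p, A p = - p).
Proof.
move=> Zu irru cA AK Arho; have [a ca AE] := centroid_rho_diag Zu cA Arho.
have aK : involutive a by move=> x; have := AK (x, 0); rewrite !AE => /(congr1 fst).
have irr_id : irreducible_under (id : u -> u) id by move=> V iV _ _; apply: irru.
have [a1|aN1] := irreducible_centroid_sign irr_id ca aK (fun=> erefl) (fun=> erefl).
- by left=> -[x y]; rewrite AE !a1.
- by right=> -[x y]; rewrite AE !aN1.
Qed.

Definition prod_lfun (a b : 'End(u)) : 'End((u * u)%type) :=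
  linfun (fun p : u * u => (a p.1, b p.2) : u * u).

Lemma prod_lfunE a b p : prod_lfun a b p = (a p.1, b p.2).
Proof.
pose f (p : u * u) : u * u := (a p.1, b p.2).
have fL : linear f by move=> k q r; congr pair; rewrite /= linearP.
pose fB := GRing.isLinear.Build R _ _ _ _ fL.
exact: (lfunE (HB.pack f fB : {linear (u * u)%type -> (u * u)%type})).
Qed.

Lemma rho_sign_swap : exists E : 'End((u * u)%type),
  [/\ centroid E, forall p, E (E p) = 1 *: p,
      forall p, E (rho p) = -1 *: rho (E p) & forall p, E p = (p.1, - p.2)].
Proof.
pose E := prod_lfun \1%VF (- \1)%VF.
have EE p : E p = (p.1, - p.2) by rewrite prod_lfunE opp_lfunE !id_lfunE.
exists E; split=> // p; rewrite ?EE.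
- by move=> q; rewrite !EE; congr pair; rewrite /= lieNl.
- by rewrite /= opprK scale1r -surjective_pairing.
- by congr pair; rewrite /= scaleN1r ?opprK.
Qed.

End Doubled.

End Triples.

(** * Centroid signs of the compact model triads *)

Section FromTriadTypes.
Variables (R : realType) (T : triple R).

Lemma compact_simple_neq0 (u : lieAlgType R) :
  compact_simple u -> exists x : u, x <> 0.
Proof.
move=> [[[x [y xy]] _] _]; exists x => x0; apply: xy.
by rewrite x0 lie0l.
Qed.

(** On the double of a simple algebra, a centroid involution that commutes with
    the exchange is 1 or -1, and these anticommute with no injective map. *)
Lemma rho_centroid_absurd (u : lieAlgType R) (m : u * u -> u * u) :
  compact_simple u -> {morph m : p / - p} -> (forall p, m p = 0 -> p = 0) ->
  forall A : 'End((u * u)%type), centroid A -> (forall p, A (A p) = 1 *: p) ->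
  (forall p, A (rho p) = 1 *: rho (A p)) -> (forall p, A (m p) = -1 *: m (A p)) ->
  False.
Proof.
move=> cu mN m0 A cA AA Arho Am; have [x x0] := compact_simple_neq0 cu.
apply: x0; suff /(congr1 fst) : (x, 0) = 0 :> u * u by [].
apply: (sign_antiE mN m0 _ Am); apply: centroid_rho_sign => //.
- exact: compact_centerless cu.2.
- exact: cu.1.2.
- by move=> p; rewrite AA scale1r.
- by move=> p; rewrite Arho scale1r.
Qed.

Section Model.
Variables (u : lieAlgType R) (nu : 'End(u)).
Hypotheses (cu : compact_simple u) (nuI : lie_involution nu).

Let nu0 x : nu x = 0 -> x = 0.
Proof. by move=> nx; rewrite -[x]nuI.2 nx linear0. Qed.

Let oplusN : {morph oplus nu nu : p / - p}.
Proof. by move=> p; congr pair; rewrite /= linearN. Qed.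

Let oplus0 p : oplus nu nu p = 0 -> p = 0.
Proof. by case: p => x y [/nu0-> /nu0->]. Qed.

Lemma T_a_centroid : T ≡ @Triple R (u * u)%type (@rho u) (@rho u \o oplus nu nu) ->
  has_centroid T 1 (-1) (-1) /\ ~ has_centroid T 1 1 (-1).
Proof.
move=> TT; split; last first.
  move=> /(has_centroid_equiv TT)[A [cA AA A1 A2]].
  apply: (rho_centroid_absurd cu _ _ cA AA A1 A2) => /= [p|p].
    by congr pair; rewrite /= linearN.
  by case: p => x y [/nu0-> /nu0->].
apply: (has_centroid_equiv (triple_equiv_sym TT)).
have [E [cE EE Erho Ep]] := rho_sign_swap u; exists E; split=> //= p.
by rewrite !Ep; congr pair; rewrite /= scaleN1r ?linearN ?opprK.
Qed.

Lemma T_b_centroid : T ≡ @Triple R (u * u)%type (@rho u) (oplus nu nu) ->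
  has_centroid T 1 (-1) 1 /\ ~ has_centroid T 1 1 (-1).
Proof.
move=> TT; split; last first.
  move=> /(has_centroid_equiv TT)[A [cA AA A1 A2]].
  exact: (rho_centroid_absurd cu oplusN oplus0 cA AA A1 A2).
apply: (has_centroid_equiv (triple_equiv_sym TT)).
have [E [cE EE Erho Ep]] := rho_sign_swap u; exists E; split=> //= p.
by rewrite !Ep; congr pair; rewrite /= scale1r ?linearN.
Qed.

Lemma T_d_centroid : T ≡ @Triple R (u * u)%type (oplus nu nu) (@rho u) ->
  has_centroid T 1 1 (-1) /\ ~ has_centroid T 1 (-1) 1.
Proof.
move=> TT; split; last first.
  move=> /(has_centroid_equiv TT)[A [cA AA A1 A2]].
  exact: (rho_centroid_absurd cu oplusN oplus0 cA AA A2 A1).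
apply: (has_centroid_equiv (triple_equiv_sym TT)).
have [E [cE EE Erho Ep]] := rho_sign_swap u; exists E; split=> //= p.
by rewrite !Ep; congr pair; rewrite /= scale1r ?linearN.
Qed.

End Model.

Section Four.
Variables (u : lieAlgType R) (a b c d : R).
Let diag4 (p : u * u * u * u) : u * u * u * u :=
  (a *: p.1.1.1, b *: p.1.1.2, c *: p.1.2, d *: p.2).

Let diag4_linear : linear diag4.
Proof.
move=> k p q; rewrite /diag4; congr (_, _, _, _);
by rewrite /= scalerDr !scalerA [_ * k]mulrC.
Qed.

Lemma diag4_lfun : exists A : 'End((u * u * u * u)%type), A =1 diag4.
Proof.
pose AL := GRing.isLinear.Build R _ _ _ _ diag4_linear.
pose A0 : {linear (u * u * u * u)%type -> (u * u * u * u)%type} := HB.pack diag4 AL.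
by exists (linfun A0) => p; rewrite lfunE.
Qed.

End Four.

(** The two splittings of the four factors are {1,2} against {3,4} and {1,4}
    against {2,3}, the orbits of the two exchanges. *)
Lemma T_c_centroid : T_c T -> has_centroid T 1 1 (-1) /\ has_centroid T 1 (-1) 1.
Proof.
move=> [u cu TT]; split; apply: (has_centroid_equiv (triple_equiv_sym TT)).
  have [A AE] := diag4_lfun u 1 1 (-1) (-1); exists A.
  split=> /= -[[[x y] z] w]; rewrite ?AE /=.
  - move=> [[[x' y'] z'] w']; rewrite !AE; congr (_, _, _, _);
    exact: (esym (lieZl _ _ _)).
  - by congr (_, _, _, _); rewrite /= ?scaleN1r ?opprK ?scale1r.
  - by congr (_, _, _, _); rewrite /= ?scaleN1r ?opprK ?scale1r.
  - by congr (_, _, _, _); rewrite /= ?scaleN1r ?opprK ?scale1r.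
have [A AE] := diag4_lfun u 1 (-1) (-1) 1; exists A.
split=> /= -[[[x y] z] w]; rewrite ?AE /=.
- move=> [[[x' y'] z'] w']; rewrite !AE; congr (_, _, _, _);
  exact: (esym (lieZl _ _ _)).
- by congr (_, _, _, _); rewrite /= ?scaleN1r ?opprK ?scale1r.
- by congr (_, _, _, _); rewrite /= ?scaleN1r ?opprK ?scale1r.
- by congr (_, _, _, _); rewrite /= ?scaleN1r ?opprK ?scale1r.
Qed.

End FromTriadTypes.

(** * Triads with prescribed centroid signs *)

Section ToTriadTypes.
Variables (R : realType) (L : lieAlgType R) (th sg : 'End(L)).
Hypotheses (thI : lie_involution th) (sgI : lie_involution sg).
Hypothesis thsg : forall x, th (sg x) = sg (th x).
Hypotheses (cL : compact_type L) (L0 : exists x : L, x <> 0).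
Hypothesis irrL : irreducible_under th sg.
Local Notation T := (@Triple R L th sg).

Lemma fixed_compact_simple (E tau mu : 'End(L)) (cE : centroid E) :
  involutive E -> lie_involution tau -> (forall x, E (tau x) = - tau (E x)) ->
  irreducible_under tau mu -> lie_involution mu ->
  (forall x, mu (tau x) = tau (mu x)) ->
  no_anti_centroid tau mu ->
  compact_simple (subvs_of (fixed_alg cE)).
Proof.
move=> EK tauI Etau irrt muI mutau noA.
have cU : compact_type (subvs_of (fixed_alg cE)) := compact_fixed EK cL.
split=> //; apply: centerless_simple.
- exact: compact_centerless.
- exact: fixed_neq0 EK tauI Etau L0.
- exact: no_ideal_fixed EK tauI Etau mu irrt muI mutau noA.
Qed.

Lemma restr_lfun_involution (E nu : 'End(L)) (cE : centroid E) :
  lie_involution nu -> (forall x, E (nu x) = nu (E x)) ->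
  lie_involution (restr_lfun (fixed_alg cE) nu).
Proof.
move=> nuI Enu.
have rE := @restr_lfun_fixedE _ _ _ cE _ Enu.
apply: lie_involutionI => [x y|x]; apply: val_inj; rewrite /= !rE /= ?nuI.1.1//.
exact: nuI.2.
Qed.

Lemma has_centroid_unit (s t : R) : has_centroid T 1 s t -> exists E : 'End(L),
  [/\ centroid E, involutive E, forall x, E (th x) = s *: th (E x)
    & forall x, E (sg x) = t *: sg (E x)].
Proof. by move=> [E [cE EE E1 E2]]; exists E; split=> // x; rewrite EE scale1r. Qed.

Let no_commth : ~ has_centroid T 1 1 (-1) -> no_anti_centroid th sg.
Proof.
move=> noG [A [cA AK A1 A2]]; apply: noG; exists A.
by split=> // x; rewrite ?A1 ?A2 ?AK ?scale1r ?scaleN1r.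
Qed.

Let no_commsg : ~ has_centroid T 1 (-1) 1 -> no_anti_centroid sg th.
Proof.
move=> noG [A [cA AK A1 A2]]; apply: noG; exists A.
by split=> // x; rewrite ?A1 ?A2 ?AK ?scale1r ?scaleN1r.
Qed.

Let sgth x : sg (th x) = th (sg x). Proof. by rewrite thsg. Qed.

Lemma centroid_T_a :
  has_centroid T 1 (-1) (-1) -> ~ has_centroid T 1 1 (-1) -> T_a T.
Proof.
move=> /has_centroid_unit[E [cE EK E1 E2]] noG.
have Eth x : E (th x) = - th (E x) by rewrite E1 scaleN1r.
have Esg x : E (sg x) = - sg (E x) by rewrite E2 scaleN1r.
(* Both th and sg exchange the two ideals, so their product preserves each. *)
have nuI : lie_involution (th \o sg)%VF.
  apply: lie_involutionI => [x y|x]; rewrite !comp_lfunE ?sgI.1.1 ?thI.1.1//.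
  by rewrite sgth sgI.2 thI.2.
have Enu x : E ((th \o sg)%VF x) = (th \o sg)%VF (E x).
  by rewrite !comp_lfunE Eth Esg linearN opprK.
have cs := fixed_compact_simple cE EK thI Eth irrL sgI sgth (no_commth noG).
exists (subvs_of (fixed_alg cE)) => //.
exists (restr_lfun (fixed_alg cE) (th \o sg)%VF); first exact: restr_lfun_involution.
apply: triple_equiv_sym; exists (split_map th cE); split=> [|p|p] /=.
- exact: split_iso.
- exact: split_map_rho.
rewrite split_map_rho//.
rewrite /oplus !restr_lfunE -/(oplus (restr _) (restr _) p).
rewrite split_map_oplus//; first by rewrite comp_lfunE thI.2.
by move=> x; rewrite !comp_lfunE sgth.
Qed.

Lemma centroid_T_b :
  has_centroid T 1 (-1) 1 -> ~ has_centroid T 1 1 (-1) -> T_b T.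
Proof.
move=> /has_centroid_unit[E [cE EK E1 E2]] noG.
have Eth x : E (th x) = - th (E x) by rewrite E1 scaleN1r.
have Esg x : E (sg x) = sg (E x) by rewrite E2 scale1r.
have cs := fixed_compact_simple cE EK thI Eth irrL sgI sgth (no_commth noG).
exists (subvs_of (fixed_alg cE)) => //.
exists (restr_lfun (fixed_alg cE) sg); first exact: restr_lfun_involution.
apply: triple_equiv_sym; exists (split_map th cE); split=> [|p|p] /=.
- exact: split_iso.
- exact: split_map_rho.
by rewrite -split_map_oplus// /oplus !restr_lfunE.
Qed.

Lemma centroid_T_d :
  has_centroid T 1 1 (-1) -> ~ has_centroid T 1 (-1) 1 -> T_d T.
Proof.
move=> /has_centroid_unit[E [cE EK E1 E2]] noG.
have Eth x : E (th x) = th (E x) by rewrite E1 scale1r.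
have Esg x : E (sg x) = - sg (E x) by rewrite E2 scaleN1r.
have irrL' : irreducible_under sg th by move=> V iV ? ?; apply: irrL.
have cs := fixed_compact_simple cE EK sgI Esg irrL' thI thsg (no_commsg noG).
exists (subvs_of (fixed_alg cE)) => //.
exists (restr_lfun (fixed_alg cE) th); first exact: restr_lfun_involution.
apply: triple_equiv_sym; exists (split_map sg cE); split=> [|p|p] /=.
- exact: split_iso.
- by rewrite -split_map_oplus// /oplus !restr_lfunE.
- exact: split_map_rho.
Qed.

End ToTriadTypes.

(** Splitting twice: F splits off U = ker (F - 1) with sg as the exchange, and E
    restricted to U splits U with th as the exchange. *)
Lemma centroid_T_c (R : realType) (L : lieAlgType R) (th sg : 'End(L)) :
  lie_involution th -> lie_involution sg -> (forall x, th (sg x) = sg (th x)) ->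
  compact_type L -> (exists x : L, x <> 0) -> irreducible_under th sg ->
  has_centroid (@Triple R L th sg) 1 1 (-1) ->
  has_centroid (@Triple R L th sg) 1 (-1) 1 ->
  T_c (@Triple R L th sg).
Proof.
move=> thI sgI thsg cL L0 irrL.
move=> /has_centroid_unit[F [cF FK F1 F2]] /has_centroid_unit[E [cE EK E1 E2]].
have Fth x : F (th x) = th (F x) by rewrite F1 scale1r.
have Fsg x : F (sg x) = - sg (F x) by rewrite F2 scaleN1r.
have Eth x : E (th x) = - th (E x) by rewrite E1 scaleN1r.
have Esg x : E (sg x) = sg (E x) by rewrite E2 scale1r.
have FE x : F (E x) = E (F x) by apply: centroidC => //; apply: compact_centerless.
pose U := subvs_of (fixed_alg cF).
pose thU := restr_lfun (fixed_alg cF) th; pose EU := restr_lfun (fixed_alg cF) E.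
have rth := @restr_lfun_fixedE _ _ _ cF _ Fth.
have rE := @restr_lfun_fixedE _ _ _ cF _ FE.
have thUI : lie_involution thU by apply: restr_lfun_involution.
have cEU : centroid EU.
  by move=> x y; apply: val_inj; rewrite /= !rE /= cE.
have EUK : involutive EU by move=> x; apply: val_inj; rewrite /= !rE.
have EUth x : EU (thU x) = - thU (EU x) by apply: val_inj; rewrite /= rE !rth rE Eth.
have irrL' : irreducible_under sg th by move=> V iV ? ?; apply: irrL.
have irrU : irreducible_under thU (\1%VF : 'End(U)).
  move=> V iV thV _.
  have := @irreducible_fixed _ _ F sg cF FK sgI Fsg th irrL' _ Fth V iV.
  by apply=> // x xV; rewrite -restr_lfunE thV.
have cU : compact_type U := compact_fixed FK cL.
have U0 : exists x : U, x <> 0 := fixed_neq0 cF FK sgI Fsg L0.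
have cs : compact_simple (subvs_of (fixed_alg cEU)).
  apply: (fixed_compact_simple cU U0 cEU EUK thUI EUth irrU (lie_involution1 U)).
    by move=> x; rewrite !id_lfunE.
  exact: no_anti_centroid1.
exists (subvs_of (fixed_alg cEU)) => //; apply: triple_equiv_sym.
pose u := subvs_of (fixed_alg cEU).
pose f1 : 'Hom((U * U)%type, L) := split_map sg cF.
pose f2 : 'Hom((u * u)%type, U) := split_map thU cEU.
have [[f1M f1B] [f2M f2B]] : lie_iso f1 /\ lie_iso f2.
  by split; apply: split_iso.
have f1rho p : f1 (rho p) = sg (f1 p) by apply: split_map_rho.
have f2rho p : f2 (rho p) = thU (f2 p) by apply: split_map_rho.
have f1th p q : f1 (thU p, thU q) = th (f1 (p, q)).
  by rewrite -[RHS]split_map_oplus// /oplus /thU !restr_lfunE.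
(* sg exchanges the factors 1 and 4 and the factors 2 and 3, so the summand sg U
   carries the coordinates 4 and 3 in this order. *)
pose pair4 (p : u * u * u * u) : U * U :=
  (f2 (p.1.1.1, p.1.1.2), f2 (p.2, p.1.2)).
have pair4L : linear pair4.
  by move=> k p q; rewrite /pair4; congr pair; rewrite /= -[RHS]linearP.
pose gL := GRing.isLinear.Build R _ _ _ _ pair4L.
pose g0 : {linear (u * u * u * u)%type -> (U * U)%type} := HB.pack pair4 gL.
have [g gE] : exists g : 'Hom((u * u * u * u)%type, (U * U)%type), g =1 pair4.
  by exists (linfun g0) => p; rewrite lfunE.
clearbody f1 f2; exists (f1 \o g)%VF; split=> /= [|[[[x y] z] w]|[[[x y] z] w]].
- split=> [p q|].
    by rewrite !comp_lfunE !gE -f1M; congr (f1 _); congr pair; rewrite /= -f2M.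
  apply: (@eq_bij _ _ (f1 \o pair4)); last by move=> p; rewrite /= comp_lfunE gE.
  apply: bij_comp => //; have [h fh hf] := f2B.
  exists (fun q => (h q.1, (h q.2).2, (h q.2).1)) => [[[[x y] z] w]|[p q]].
    by rewrite /pair4 /= !fh.
  by rewrite /pair4 /= -!surjective_pairing !hf.
- by rewrite !comp_lfunE !gE -f1th /pair4 /= -!f2rho.
- by rewrite !comp_lfunE !gE -f1rho.
Qed.

(** * The dual as a twisted bracket *)

Section Dual.
Variables (R : realType) (P : symmetricPair R).
Local Notation th := (theta P).
Local Notation sg := (sigma P).
Local Notation D := (carrier (dual P)).

Let thI : lie_involution th := (theta_cartan P).1.
Let thM : {morph th : x y / lie x y} := thI.1.1.
Let thK : involutive th := thI.2.
Let thsg x : th (sg x) = sg (th x) := theta_sigma x.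

Definition theta_even : 'End(P) := 2^-1 *: (\1%VF + th).
Definition theta_odd : 'End(P) := 2^-1 *: (\1%VF - th).

Lemma theta_evenE x : theta_even x = 2^-1 *: (x + th x).
Proof. by rewrite scale_lfunE add_lfunE id_lfunE. Qed.

Lemma theta_oddE x : theta_odd x = 2^-1 *: (x - th x).
Proof. by rewrite scale_lfunE add_lfunE id_lfunE opp_lfunE. Qed.

Lemma theta_even_odd x : theta_even x + theta_odd x = x.
Proof. by rewrite theta_evenE theta_oddE -scalerDr half_sumK. Qed.

Lemma theta_of_even x : th (theta_even x) = theta_even x.
Proof. by rewrite theta_evenE linearZ linearD /= thK addrC. Qed.

Lemma theta_of_odd x : th (theta_odd x) = - theta_odd x.
Proof. by rewrite theta_oddE linearZ linearB /= thK -scalerN opprB. Qed.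

Lemma even_theta x : theta_even (th x) = theta_even x.
Proof. by rewrite !theta_evenE thK addrC. Qed.

Lemma odd_theta x : theta_odd (th x) = - theta_odd x.
Proof. by rewrite !theta_oddE thK -scalerN opprB. Qed.

Lemma even_comm (f : 'End(P)) : (forall x, th (f x) = f (th x)) ->
  forall x, theta_even (f x) = f (theta_even x).
Proof.
move=> thf x.
by rewrite !theta_evenE [RHS]linearZ /= [f (_ + _)]linearD /= thf.
Qed.

Lemma odd_comm (f : 'End(P)) : (forall x, th (f x) = f (th x)) ->
  forall x, theta_odd (f x) = f (theta_odd x).
Proof.
move=> thf x.
by rewrite !theta_oddE [RHS]linearZ /= [f (_ - _)]linearB /= thf.
Qed.

Lemma theta_even_sub_odd x : th x = theta_even x - theta_odd x.
Proof.
by rewrite -[in LHS](theta_even_odd x) linearD /= theta_of_even theta_of_odd.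
Qed.

Lemma theta_evenP x : th x = x -> theta_even x = x /\ theta_odd x = 0.
Proof.
move=> thx; have od0 : theta_odd x = 0 by rewrite theta_oddE thx subrr scaler0.
by split=> //; rewrite -[RHS](theta_even_odd x) od0 addr0.
Qed.

Lemma theta_oddP x : th x = - x -> theta_even x = 0 /\ theta_odd x = x.
Proof.
move=> thx; have ev0 : theta_even x = 0 by rewrite theta_evenE thx subrr scaler0.
by split=> //; rewrite -[RHS](theta_even_odd x) ev0 add0r.
Qed.

(** The bracket of the dual, carried back to g0 along
    x = k + p |-> k + sqrt(-1) p: it is [x, y] with a change of sign when both x
    and y are (-1)-eigenvectors of theta. *)
Definition twisted_lie (x y : P) : P :=
  lie x (theta_even y) + lie (th x) (theta_odd y).

Lemma theta_twisted_lie x y :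
  th (twisted_lie x y) = twisted_lie (th x) (th y).
Proof.
rewrite /twisted_lie linearD /= !thM theta_of_even theta_of_odd.
by rewrite even_theta odd_theta.
Qed.

(** Twisting twice restores the bracket. *)
Lemma lie_untwist x y :
  lie x y = twisted_lie x (theta_even y) + twisted_lie (th x) (theta_odd y).
Proof.
have [ee eo] := theta_evenP (theta_of_even y).
have [oe oo] := theta_oddP (theta_of_odd y).
by rewrite /twisted_lie ee eo oe oo !lie0r add0r addr0 thK -lieDr theta_even_odd.
Qed.

Lemma twisted_lieNl x y : twisted_lie (- x) y = - twisted_lie x y.
Proof. by rewrite /twisted_lie linearN !lieNl opprD. Qed.

Lemma twisted_lieNr x y : twisted_lie x (- y) = - twisted_lie x y.
Proof. by rewrite /twisted_lie !linearN /= opprD. Qed.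

Definition dual_pair (x : P) : complexification P :=
  (theta_even x, theta_odd x).

Lemma dual_pair_in x : dual_pair x \in dual_alg P.
Proof. by apply/dual_vspaceP; rewrite /= theta_of_even theta_of_odd. Qed.

Definition to_dual_fun (x : P) : D := Subvs (dual_pair_in x).

Fact to_dual_linear : linear to_dual_fun.
Proof.
by move=> k x y; apply: val_inj; congr pair; rewrite /= linearP.
Qed.
HB.instance Definition _ :=
  GRing.isLinear.Build R P D _ to_dual_fun to_dual_linear.

Definition of_dual_fun (z : D) : P := (vsval z).1 + (vsval z).2.

Lemma to_dualK : cancel to_dual_fun of_dual_fun.
Proof. by move=> x; rewrite /of_dual_fun /= theta_even_odd. Qed.

Lemma of_dualK : cancel of_dual_fun to_dual_fun.
Proof.
move=> z; apply: val_inj; have /dual_vspaceP[] := subvsP z.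
rewrite /of_dual_fun /=; case: (vsval z) => a b /=.
move=> /theta_evenP[eva oda] /theta_oddP[evb odb].
by rewrite /dual_pair !linearD /= eva oda evb odb addr0 add0r.
Qed.

Definition to_dual : 'Hom(P, D) := linfun to_dual_fun.

Lemma to_dualE x : to_dual x = to_dual_fun x.
Proof. exact: lfunE. Qed.

Lemma even_twisted_lie x y : theta_even (twisted_lie x y) =
  lie (theta_even x) (theta_even y) - lie (theta_odd x) (theta_odd y).
Proof.
rewrite theta_evenE /twisted_lie [th (_ + _)]linearD /= !thM.
rewrite theta_of_even theta_of_odd thK lieNr addrACA -lieDl.
rewrite -lieNl -lieDl -[th x - x]opprB lieNl scalerBr.
by rewrite -!lieZl -theta_evenE -theta_oddE.
Qed.

Lemma odd_twisted_lie x y : theta_odd (twisted_lie x y) =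
  lie (theta_even x) (theta_odd y) + lie (theta_odd x) (theta_even y).
Proof.
rewrite theta_oddE /twisted_lie [th (_ + _)]linearD /= !thM.
rewrite theta_of_even theta_of_odd thK lieNr.
rewrite opprD opprK addrACA -lieNl -!lieDl scalerDr -!lieZl [th x + x]addrC.
by rewrite -theta_evenE -theta_oddE addrC.
Qed.

Lemma lie_to_dual x y : lie (to_dual x) (to_dual y) = to_dual (twisted_lie x y).
Proof.
rewrite !to_dualE; apply: val_inj.
by rewrite /= /dual_pair even_twisted_lie odd_twisted_lie.
Qed.

Definition of_dual : 'Hom(D, P) := (to_dual^-1)%VF.

Lemma to_dual_inj : lker to_dual == 0%VS.
Proof. by apply/lker0P => x y; rewrite !to_dualE => /(can_inj to_dualK). Qed.

Lemma of_to_dual : cancel to_dual of_dual.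
Proof. exact: lker0_lfunK to_dual_inj. Qed.

Lemma to_of_dual : cancel of_dual to_dual.
Proof.
move=> z; have -> : z = to_dual (of_dual_fun z) by rewrite to_dualE of_dualK.
by rewrite of_to_dual.
Qed.

Definition dual_end (f : 'End(P)) : 'End(D) := (to_dual \o (f \o of_dual))%VF.

Lemma dual_endE f x : dual_end f (to_dual x) = to_dual (f x).
Proof. by rewrite !comp_lfunE of_to_dual. Qed.

Lemma to_dualP z : exists x, z = to_dual x.
Proof. by exists (of_dual z); rewrite to_of_dual. Qed.

Lemma map1_dual z : @map1 R (dual P) z = dual_end th z.
Proof.
have [x ->] := to_dualP z; rewrite dual_endE; apply: val_inj.
rewrite [LHS]dual_theta !to_dualE /= /complex_ext /dual_pair /=.
by rewrite theta_of_even theta_of_odd even_theta odd_theta.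
Qed.

Lemma map2_dual z : @map2 R (dual P) z = dual_end sg z.
Proof.
have [x ->] := to_dualP z; rewrite dual_endE; apply: val_inj.
rewrite [LHS]dual_sigma !to_dualE /= /complex_ext /dual_pair /=.
by rewrite !(even_comm, odd_comm).
Qed.

Lemma dual_end_involution (f : 'End(P)) : lie_involution f ->
  (forall x, th (f x) = f (th x)) -> lie_involution (dual_end f).
Proof.
move=> fI thf; have fK : involutive (dual_end f).
  by move=> z; have [x ->] := to_dualP z; rewrite !dual_endE fI.2.
split=> //; split; last by exists (dual_end f).
move=> z w; have [x ->] := to_dualP z; have [y ->] := to_dualP w.
rewrite !dual_endE !lie_to_dual dual_endE; congr (to_dual _).
by rewrite /twisted_lie linearD /= !fI.1.1 even_comm// odd_comm// thf.
Qed.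

(** With A = ad k and B = ad p for x = k + p, the adjoint of the image of x is
    A + B theta.  Since theta commutes with A and anticommutes with B, the cross
    terms have trace zero and (B theta)^2 = - B^2, which leaves tr A^2 - tr B^2,
    the value of the Killing form at (x, theta x). *)
Lemma killing_to_dual x : killing (to_dual x) (to_dual x) = killing x (th x).
Proof.
pose A := ad (theta_even x); pose B := ad (theta_odd x).
have thA : (th \o A = A \o th)%VF.
  by apply/lfunP => y; rewrite !comp_lfunE !adE thM theta_of_even.
have thB : (th \o B = - (B \o th))%VF.
  by apply/lfunP => y; rewrite opp_lfunE !comp_lfunE !adE thM theta_of_odd lieNl.
have thth : (th \o th = \1)%VF.
  by apply/lfunP => y; rewrite comp_lfunE id_lfunE thK.
have adD : ad (to_dual x) = (to_dual \o ((A + (B \o th)) \o of_dual))%VF.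
  apply/lfunP => z; have [y ->] := to_dualP z.
  rewrite adE lie_to_dual !comp_lfunE of_to_dual add_lfunE comp_lfunE !adE.
  rewrite /twisted_lie (theta_even_sub_odd x) (theta_even_sub_odd y).
  rewrite -{1}(theta_even_odd x) -[in lie (theta_even x) y](theta_even_odd y).
  by rewrite !(lieDl, lieDr) lieNl lieNr addrACA.
have adx : ad x = A + B.
  by apply/lfunP => y; rewrite add_lfunE !adE -lieDl theta_even_odd.
have adthx : ad (th x) = A - B.
  apply/lfunP => y; rewrite add_lfunE opp_lfunE !adE -lieNl -lieDl.
  by rewrite -theta_even_sub_odd.
pose C : 'End(P) := (A + (B \o th))%VF.
have -> : killing (to_dual x) (to_dual x) = lftrace (C \o C)%VF.
  have ad2 : (ad (to_dual x) \o ad (to_dual x) =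
              to_dual \o ((C \o C) \o of_dual))%VF.
    by rewrite adD; apply/lfunP => z; rewrite !comp_lfunE of_to_dual.
  rewrite /killing ad2 lftrace_cyclic; congr lftrace.
  by apply/lfunP => y; rewrite !comp_lfunE of_to_dual.
(* Conjugation by theta preserves the trace and changes the sign of H theta. *)
have cross (H : 'End(P)) :
    (th \o H = - (H \o th))%VF -> lftrace (H \o th)%VF = 0.
  move=> thH; apply/eqP; rewrite -eqNr; apply/eqP.
  by rewrite [in RHS]lftrace_cyclic thH linearN.
have AB0 : lftrace ((A \o B) \o th)%VF = 0.
  apply: cross.
  by rewrite comp_lfunA thA -comp_lfunA thB comp_lfunNr comp_lfunA.
have BA0 : lftrace ((B \o A) \o th)%VF = 0.
  apply: cross.
  by rewrite comp_lfunA thB comp_lfunNl -(comp_lfunA B th A) thA comp_lfunA.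
have BB : ((B \o th) \o (B \o th) = - (B \o B))%VF.
  rewrite -comp_lfunA (comp_lfunA th) thB comp_lfunNl -comp_lfunA thth.
  by rewrite comp_lfun1r comp_lfunNr.
rewrite /killing adx adthx /C !(comp_lfunDl, comp_lfunDr) !comp_lfunNr.
rewrite BB (comp_lfunA A) -(comp_lfunA B th) thA (comp_lfunA B).
rewrite !linearD !linearN /= AB0 BA0 (lftrace_cyclic A B); ring.
Qed.

End Dual.

(** * Centroids of the pair and of its dual *)

Section DualTriad.
Variables (R : realType) (P : symmetricPair R).
Local Notation th := (theta P).
Local Notation sg := (sigma P).
Local Notation D := (carrier (dual P)).

Let thI : lie_involution th := (theta_cartan P).1.
Let thM : {morph th : x y / lie x y} := thI.1.1.
Let thK : involutive th := thI.2.
Let thsg x : th (sg x) = sg (th x) := theta_sigma x.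

(** The dual with its two involutions given as linear endomorphisms, to which
    the results on splittings apply. *)
Definition dual_triad : triple R :=
  @Triple R D (dual_end th) (dual_end sg).

Lemma dual_triadE : dual P ≡ dual_triad.
Proof.
exists \1%VF; split=> [|x|x]; rewrite ?id_lfunE ?map1_dual ?map2_dual//.
split=> [x y|]; first by rewrite !id_lfunE.
by exists id => x; rewrite id_lfunE.
Qed.

Lemma dual_end_comm z :
  dual_end th (dual_end sg z) = dual_end sg (dual_end th z).
Proof. by have [x ->] := to_dualP z; rewrite !dual_endE thsg. Qed.

Lemma killing_theta_lt0 x : x != 0 -> killing x (th x) < 0.
Proof. by move=> /(theta_cartan P).2; rewrite oppr_gt0. Qed.

Lemma dual_compact : compact_type D.
Proof.
move=> z; have [x ->] := to_dualP z => x0; rewrite killing_to_dual.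
by apply: killing_theta_lt0; apply: contra_neq x0 => ->; rewrite linear0.
Qed.

(** The zero algebra is vacuously of compact type. *)
Lemma pair_neq0 : exists x : P, x <> 0.
Proof.
have [P0|PN0] := eqVneq ({:P}%VS) 0%VS; last first.
  by exists (vpick {:P}); apply/eqP; rewrite vpick0.
case: (@g0_noncompact R P) => x; have := memvf x.
by rewrite P0 memv0 => /eqP->; rewrite eqxx.
Qed.

(** A central x satisfies B(x, theta x) = 0. *)
Lemma pair_centerless : centerless P.
Proof.
move=> x xZ; apply/eqP/negPn/negP => /killing_theta_lt0.
by rewrite killing_central// ltxx.
Qed.

Lemma dual_neq0 : exists z : D, z <> 0.
Proof.
have [x x0] := pair_neq0; exists (to_dual P x) => tx0; apply: x0.
by rewrite -[x]of_to_dual tx0 linear0.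
Qed.

Hypothesis irrP : irreducible P.

Lemma pair_irreducible : irreducible_under sg (id : P -> P).
Proof.
move=> V iV sgV _; apply: irrP => //.
by apply/subvP => _ /memv_imgP[x xV ->]; apply: sgV.
Qed.

(** For a theta-stable subspace, being an ideal for either of the two brackets
    is the same. *)
Lemma dual_irreducible : irreducible_under (dual_end th) (dual_end sg).
Proof.
move=> V iV thV sgV; pose W := (to_dual P @^-1: V)%VS.
have inW x : (x \in W) = (to_dual P x \in V) by rewrite memv_preim.
have thW x : x \in W -> th x \in W by rewrite !inW -dual_endE; apply: thV.
have evW x : x \in W -> theta_even P x \in W.
  by move=> xW; rewrite theta_evenE memvZ// memvD// thW.
have odW x : x \in W -> theta_odd P x \in W.
  by move=> xW; rewrite theta_oddE memvZ// memvB// thW.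
have iW : is_ideal W.
  move=> x y yW; rewrite inW lie_untwist linearD /= -!lie_to_dual.
  by rewrite memvD// iV// -inW ?evW ?odW.
have sgW : {homo sg : x / x \in W}.
  by move=> x; rewrite !inW -dual_endE; apply: sgV.
have [W0|WT] := pair_irreducible iW sgW (fun _ xW => xW); [left|right].
  apply/eqP; rewrite -subv0; apply/subvP => z; have [x ->] := to_dualP z.
  by rewrite -inW W0 memv0 => /eqP->; rewrite linear0 mem0v.
apply/eqP; rewrite eqEsubv subvf; apply/subvP => z _; have [x ->] := to_dualP z.
by rewrite -inW WT memvf.
Qed.

Definition sigma_has_centroid (c s : R) := exists A : 'End(P),
  [/\ centroid A, forall x, A (A x) = c *: x
    & forall x, A (sg x) = s *: sg (A x)].

Definition is_sign (c : R) := c = 1 \/ c = -1.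

Lemma sign_sqr c : is_sign c -> c * c = 1.
Proof. by move=> [->|->]; rewrite ?mulrNN mulr1. Qed.

(** The adjoint of A for the positive definite form - B(x, theta y) is
    A' = theta A theta.  The product A' A lies in the centroid, commutes with
    sigma and has square 1, so it is 1 or -1; being positive it is 1, and then
    A' is the inverse of A, that is c A. *)
Lemma centroid_theta (A : 'End(P)) c s : is_sign c -> is_sign s ->
  centroid A -> (forall x, A (A x) = c *: x) ->
  (forall x, A (sg x) = s *: sg (A x)) -> forall x, A (th x) = c *: th (A x).
Proof.
move=> c1 s1 cA AA Asg; pose A' : 'End(P) := (th \o (A \o th))%VF.
have A'E x : A' x = th (A (th x)) by rewrite !comp_lfunE.
have cA' : centroid A' by move=> x y; rewrite !A'E thM cA thM thK.
have A'A' x : A' (A' x) = c *: x by rewrite !A'E thK AA linearZ /= thK.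
have AA' x : A (A' x) = A' (A x) by apply: centroidC pair_centerless cA cA' x.
pose Q : 'End(P) := (A' \o A)%VF.
have QE x : Q x = A' (A x) by rewrite comp_lfunE.
have cQ : centroid Q by apply: centroid_comp.
have QK : involutive Q.
  by move=> x; rewrite !QE AA' A'A' AA scalerA sign_sqr ?scale1r.
have Qsg x : Q (sg x) = sg (Q x).
  rewrite !QE !A'E Asg !linearZ /= thsg Asg !linearZ /= scalerA.
  by rewrite sign_sqr// scale1r thsg.
have [Q1|QN1] := irreducible_centroid_sign pair_irreducible cQ QK Qsg (fun=> erefl).
  move=> x; have := Q1 (A (th x)); rewrite QE AA linearZ /= => <-.
  by rewrite A'E thK.
have [x x0] := pair_neq0.
have kA : killing (A x) (th (A x)) = - killing x (th x).
  have AthA : A (th (A x)) = - th x.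
    by rewrite -[LHS]thK -A'E -QE QN1 linearN.
  by rewrite killing_centroid// AthA killingNr.
have : killing (A x) (th (A x)) <= 0.
  have [->|/killing_theta_lt0/ltW//] := eqVneq (A x) 0.
  by rewrite killing_central// => z; rewrite lie0l.
by rewrite kA oppr_le0 leNgt killing_theta_lt0//; apply/eqP.
Qed.

(** A' is A when A commutes with theta, and A theta when it anticommutes.  The
    brackets b and b' are abstract so that the lemma serves to twist and to
    untwist. *)
Lemma twist_centroid (b b' : P -> P -> P) (A : 'End(P)) (c d s : R) :
  is_sign c -> (forall x y, b (- x) y = - b x y) ->
  (forall x y, b x (- y) = - b x y) ->
  (forall x y, th (b x y) = b (th x) (th y)) ->
  (forall x y, b' x y = b x (theta_even P y) + b (th x) (theta_odd P y)) ->
  (forall x y, A (b x y) = b (A x) y) -> (forall x, A (A x) = d *: x) ->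
  (forall x, A (th x) = c *: th (A x)) -> (forall x, A (sg x) = s *: sg (A x)) ->
  exists A' : 'End(P),
    [/\ forall x y, A' (b' x y) = b' (A' x) y,
        forall x, A' (A' x) = (c * d) *: x,
        forall x, A' (th x) = c *: th (A' x)
      & forall x, A' (sg x) = s *: sg (A' x)].
Proof.
move=> c1 bNl bNr thb b'E cA AA Ath Asg.
case: c1 Ath => -> Ath.
  exists A; split=> // [x y|x]; last by rewrite mul1r.
  by rewrite !b'E linearD /= !cA Ath scale1r.
have {}Ath x : A (th x) = - th (A x) by rewrite Ath scaleN1r.
exists (A \o th)%VF; split=> [x y|x|x|x]; rewrite !comp_lfunE.
- rewrite !b'E [th (_ + _)]linearD /= !thb theta_of_even theta_of_odd thK.
  rewrite linearD /= !cA.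
  by rewrite Ath linearN /= thK !(bNl, bNr).
- by rewrite Ath AA linearZ /= thK mulN1r scaleNr.
- by rewrite !Ath scaleN1r !linearN opprK.
- by rewrite thsg Asg.
Qed.

(** Squares of elements of the pair turn into signs against theta: c = -1 is a
    complex structure of g0 on one side and a splitting of the dual exchanged by
    theta on the other. *)
Lemma dual_has_centroid (c s : R) : is_sign c -> is_sign s ->
  sigma_has_centroid c s <-> has_centroid (dual P) 1 c s.
Proof.
move=> c1 s1; split.
  move=> [A [cA AA Asg]]; have Ath := centroid_theta c1 s1 cA AA Asg.
  have [] := @twist_centroid lie (@twisted_lie R P) A c c s c1; try by [].
  - exact: lieNl.
  - by move=> x y; rewrite lieNr.
  move=> A' [cA' A'A' A'th A'sg].
  apply: (has_centroid_equiv (triple_equiv_sym dual_triadE)).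
  exists (dual_end A'); split=> /= z; have [x ->] := to_dualP z.
  - move=> w; have [y ->] := to_dualP w.
    by rewrite dual_endE !lie_to_dual dual_endE cA'.
  - by rewrite !dual_endE A'A' sign_sqr// linearZ.
  - by rewrite !dual_endE A'th linearZ.
  - by rewrite !dual_endE A'sg linearZ.
move=> /(has_centroid_equiv dual_triadE)[/= B [cB BB Bth Bsg]].
pose A : 'End(P) := (of_dual P \o (B \o to_dual P))%VF.
have AE x : to_dual P (A x) = B (to_dual P x) by rewrite !comp_lfunE to_of_dual.
have inj : injective (to_dual P) by apply: can_inj (@of_to_dual R P).
have [] := @twist_centroid (@twisted_lie R P) lie A c 1 s c1.
- exact: twisted_lieNl.
- exact: twisted_lieNr.
- exact: theta_twisted_lie.
- exact: lie_untwist.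
- by move=> x y; apply: inj; rewrite AE -!lie_to_dual cB AE.
- by move=> x; apply: inj; rewrite !AE BB linearZ.
- by move=> x; apply: inj; rewrite AE -dual_endE Bth linearZ /= -dual_endE AE.
- by move=> x; apply: inj; rewrite AE -dual_endE Bsg linearZ /= -dual_endE AE.
by move=> A' [cA' A'A' _ A'sg]; exists A'; split=> // x; rewrite A'A' mulr1.
Qed.

End DualTriad.

(** * The types of symmetric pairs *)

Section PairTypes.
Variables (R : realType) (P : symmetricPair R).
Hypothesis irrP : irreducible P.
Local Notation th := (theta P).
Local Notation sg := (sigma P).

Let sgI : lie_involution sg := sigma_involution P.
Let thsg x : th (sg x) = sg (th x) := theta_sigma x.

(** A splitting or complex structure of the model need not come with a sign
    against its second map, so the second maps are forgotten. *)
Lemma sigma_has_centroid_equiv (T : triple R) c s : triple_of P ≡ T ->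
  sigma_has_centroid P c s <-> exists A : 'End(carrier T),
   [/\ centroid A, forall x, A (A x) = c *: x
     & forall x, A (map1 x) = s *: map1 (A x)].
Proof.
move=> [f [fI f1 _]].
(* The identity commutes with everything and serves as a neutral second map. *)
have PT : @Triple R P sg id ≡ @Triple R (carrier T) (@map1 R T) id by exists f.
split=> -[A [cA AA A1]].
  have [|B [cB BB B1 _]] := @has_centroid_equiv _ _ _ c s 1 PT.
    by exists A; split=> // x; rewrite scale1r.
  by exists B.
have [|B [cB BB B1 _]] :=
    @has_centroid_equiv _ _ _ c s 1 (triple_equiv_sym PT).
  by exists A; split=> // x; rewrite scale1r.
by exists B.
Qed.

Lemma doubled_swap (U : lieSubalg P) :
  triple_of P ≡ doubled U -> sigma_has_centroid P 1 (-1).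
Proof.
move=> PU; apply/(sigma_has_centroid_equiv _ _ PU).
by have [E [cE EE Erho _]] := rho_sign_swap (subvs_of U); exists E.
Qed.

Lemma doubled_centerless (U : lieSubalg P) :
  triple_of P ≡ doubled U -> centerless (subvs_of U).
Proof.
move=> /triple_equiv_sym[f [[fM [g fK gK]] _ _]] x xZ.
have x0 : f (x, 0) = 0.
  apply: (@pair_centerless R P) => y; rewrite -[y]gK -fM.
  have -> : lie ((x, 0) : subvs_of U * subvs_of U) (g y) = 0.
    by congr pair; rewrite /= ?xZ ?lie0l.
  by rewrite linear0.
have g0 : g 0 = 0 by rewrite -[RHS]fK linear0.
by have := fK (x, 0); rewrite x0 g0 => /(congr1 fst).
Qed.

(** A complex structure J of U gives (J, J) on the double; conversely a complex
    structure that commutes with the exchange is of this form. *)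
Lemma doubled_complex (U : lieSubalg P) : triple_of P ≡ doubled U ->
  has_complex_structure (subvs_of U) <-> sigma_has_centroid P (-1) 1.
Proof.
move=> PU; split.
  move=> [J [JJ JM]]; apply/(sigma_has_centroid_equiv _ _ PU).
  exists (prod_lfun J J); split=> /= p; rewrite ?prod_lfunE.
  - by move=> q; rewrite !prod_lfunE; congr pair; rewrite /= JM.
  - by rewrite scaleN1r; congr pair; rewrite /= JJ.
  - by rewrite scale1r.
move=> /(sigma_has_centroid_equiv _ _ PU)[/= A [cA AA Arho]].
have [|a ca AE] := centroid_rho_diag (doubled_centerless PU) cA.
  by move=> p; rewrite Arho scale1r.
exists a; split=> [x|x y]; last by rewrite ca.
by have := AA (x, 0); rewrite !AE scaleN1r => /(congr1 fst).
Qed.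

Let pair_irreducible1 : irreducible_under sg (\1%VF : 'End(P)).
Proof.
move=> V iV sgV _; apply: pair_irreducible => //.
Qed.

Lemma swap_doubled : sigma_has_centroid P 1 (-1) -> exists U : lieSubalg P,
  [/\ is_ideal U, (th @: U <= U)%VS, simple (subvs_of U)
    & triple_of P ≡ doubled U].
Proof.
move=> [E [cE EE Esg]].
have Eth x : E (th x) = th (E x).
  have s1 : is_sign (1 : R) by left.
  have sN1 : is_sign (-1 : R) by right.
  by rewrite (centroid_theta irrP s1 sN1 cE EE Esg) scale1r.
have EK : involutive E by move=> x; rewrite EE scale1r.
have {}Esg x : E (sg x) = - sg (E x) by rewrite Esg scaleN1r.
exists (fixed_alg cE); split.
- exact: fixed_ideal.
- apply/subvP => _ /memv_imgP[x /fixedSpaceP Ex ->].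
  by apply/fixedSpaceP; rewrite Eth Ex.
- apply: centerless_simple.
  + exact: centerless_fixed EK (@pair_centerless R P).
  + exact: fixed_neq0 cE EK sgI Esg (pair_neq0 P).
  + apply: (no_ideal_fixed EK sgI Esg pair_irreducible1 (lie_involution1 P)).
      by move=> x; rewrite !id_lfunE.
    exact: no_anti_centroid1 (pair_neq0 P).
apply: triple_equiv_sym; exists (split_map sg cE); split=> [|p|p] /=.
- exact: split_iso.
- exact: split_map_rho.
- exact: split_map_oplus.
Qed.

(** For an irreducible pair, failing to be simple amounts to having two ideals
    exchanged by sigma. *)
Lemma simple_no_swap : simple P <-> ~ sigma_has_centroid P 1 (-1).
Proof.
split.
  move=> [_ irr] [E [cE EE Esg]]; have [x] := pair_neq0 P; apply.
  have irr_id : irreducible_under (id : P -> P) id by move=> V iV _ _; apply: irr.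
  have EK : involutive E by move=> y; rewrite EE scale1r.
  apply: (sign_antiE (linearN sg) _ _ Esg).
    by move=> y sy0; rewrite -[y]sgI.2 sy0 linear0.
  exact: irreducible_centroid_sign irr_id cE EK (fun=> erefl) (fun=> erefl).
move=> noE; apply: centerless_simple.
- exact: pair_centerless.
- exact: pair_neq0.
move=> V iV; have [V0|V0] := eqVneq V 0%VS; first by left.
have [VT|VT] := eqVneq V fullv; first by right.
case: noE; have [] := centroid_of_ideal pair_irreducible1 sgI _ iV _
  (elimN eqP V0) (elimN eqP VT).
- by move=> x; rewrite !id_lfunE.
- by move=> x; rewrite !id_lfunE.
move=> E [cE EK Esg _]; exists E; split=> // x; first by rewrite EK scale1r.
by rewrite Esg scaleN1r.
Qed.

Lemma P_aP : P_a P <->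
  sigma_has_centroid P (-1) (-1) /\ ~ sigma_has_centroid P 1 (-1).
Proof.
split=> [[/simple_no_swap nosw [J [[JJ JM] Jsg]]]|
         [[J [cJ JJ Jsg]] /simple_no_swap sP]].
  split=> //; exists J; split=> [x y|x|x]; rewrite ?JM ?scaleN1r//.
  by rewrite Jsg opprK.
split=> //; exists J; split; last by move=> x; rewrite Jsg scaleN1r opprK.
by split=> [x|x y]; rewrite ?JJ ?scaleN1r ?cJ.
Qed.

Lemma P_bP : P_b P <->
  sigma_has_centroid P (-1) 1 /\ ~ sigma_has_centroid P 1 (-1).
Proof.
split=> [[/simple_no_swap nosw [J [[JJ JM] Jsg]]]|
         [[J [cJ JJ Jsg]] /simple_no_swap sP]].
  split=> //; exists J; split=> [x y|x|x]; rewrite ?JM ?scaleN1r ?scale1r//.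
split=> //; exists J; split; last by move=> x; rewrite Jsg scale1r.
by split=> [x|x y]; rewrite ?JJ ?scaleN1r ?cJ.
Qed.

Lemma P_cP : P_c P <->
  sigma_has_centroid P 1 (-1) /\ sigma_has_centroid P (-1) 1.
Proof.
split=> [[U [_ _ _ /doubled_complex UJ PU]]|
         [/swap_doubled[U [iU thU sU PU]] J]].
  by split; [apply: doubled_swap PU|apply/UJ].
by exists U; split=> //; apply/(doubled_complex PU).
Qed.

Lemma P_dP : P_d P <->
  sigma_has_centroid P 1 (-1) /\ ~ sigma_has_centroid P (-1) 1.
Proof.
split=> [[U [_ _ _ UJ PU]]|[/swap_doubled[U [iU thU sU PU]] J]].
  by split; [apply: doubled_swap PU|move=> /(doubled_complex PU)].
by exists U; split=> //; move=> /(doubled_complex PU).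
Qed.

End PairTypes.

(** * The types of the dual *)

Section TriadTypesOfDual.
Variables (R : realType) (P : symmetricPair R).
Hypothesis irrP : irreducible P.
Local Notation dual_triad := (dual_triad P).

Let eqT : dual P ≡ dual_triad := dual_triadE P.

Let thI := dual_end_involution (theta_cartan P).1 (fun=> erefl).
Let sgI := dual_end_involution (sigma_involution P) (@theta_sigma R P).

Let transfer c s t :
  has_centroid (dual P) c s t <-> has_centroid dual_triad c s t.
Proof.
split; first exact: has_centroid_equiv.
exact: has_centroid_equiv (triple_equiv_sym eqT).
Qed.

Let thsg := dual_end_comm (P := P).
Let cD := dual_compact (P := P).
Let D0 := dual_neq0 P.
Let irrD := dual_irreducible irrP.

Lemma T_aP : T_a (dual P) <->
  has_centroid (dual P) 1 (-1) (-1) /\ ~ has_centroid (dual P) 1 1 (-1).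
Proof.
split=> [[u cu [nu nuI TT]]|[]]; first exact: T_a_centroid cu nuI TT.
move=> /transfer G /(contra_not (transfer _ _ _).2) noG.
have [u cu [nu nuI TT]] := centroid_T_a thI sgI thsg cD D0 irrD G noG.
by exists u => //; exists nu => //; apply: triple_equiv_trans eqT TT.
Qed.

Lemma T_bP : T_b (dual P) <->
  has_centroid (dual P) 1 (-1) 1 /\ ~ has_centroid (dual P) 1 1 (-1).
Proof.
split=> [[u cu [nu nuI TT]]|[]]; first exact: T_b_centroid cu nuI TT.
move=> /transfer G /(contra_not (transfer _ _ _).2) noG.
have [u cu [nu nuI TT]] := centroid_T_b thI sgI thsg cD D0 irrD G noG.
by exists u => //; exists nu => //; apply: triple_equiv_trans eqT TT.
Qed.

Lemma T_cP : T_c (dual P) <->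
  has_centroid (dual P) 1 1 (-1) /\ has_centroid (dual P) 1 (-1) 1.
Proof.
split=> [|[]]; first exact: T_c_centroid.
move=> /transfer G /transfer G'.
have [u cu TT] := centroid_T_c thI sgI thsg cD D0 irrD G G'.
by exists u => //; apply: triple_equiv_trans eqT TT.
Qed.

Lemma T_dP : T_d (dual P) <->
  has_centroid (dual P) 1 1 (-1) /\ ~ has_centroid (dual P) 1 (-1) 1.
Proof.
split=> [[u cu [nu nuI TT]]|[]]; first exact: T_d_centroid cu nuI TT.
move=> /transfer G /(contra_not (transfer _ _ _).2) noG.
have [u cu [nu nuI TT]] := centroid_T_d thI sgI thsg cD D0 irrD G noG.
by exists u => //; exists nu => //; apply: triple_equiv_trans eqT TT.
Qed.

End TriadTypesOfDual.

Theorem theorem4p18 (R : realType) (P : symmetricPair R) (hP : irreducible P) :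
  (T_a (dual P) <-> P_a P) /\
  (T_b (dual P) <-> P_b P) /\
  (T_c (dual P) <-> P_c P) /\
  (T_d (dual P) <-> P_d P).
Proof.
have one : is_sign (1 : R) by left.
have mone : is_sign (-1 : R) by right.
have complex_anti := dual_has_centroid hP mone mone.
have complex_comm := dual_has_centroid hP mone one.
have swap := dual_has_centroid hP one mone.
split; first by have := (T_aP hP, P_aP hP); case; tauto.
split; first by have := (T_bP hP, P_bP hP); case; tauto.
split; first by have := (T_cP hP, P_cP hP); case; tauto.
by have := (T_dP hP, P_dP hP); case; tauto.
Qed.
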